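(* Let $\alpha$ and $\beta$ be ribbons. Then $g_\alpha = g_\beta$ if and only if $\alpha = \beta$ or $\alpha = \beta^*$.
   Context: A skew shape $\lambda/\mu$ is a pair of partitions with $\mu_i\le\lambda_i$ for all $i$; its Young diagram (English notation, rows numbered from top to bottom) consists of the boxes in the Young diagram of $\lambda$ that are not in that of $\mu$. Diagrams are considered up to translation. A skew shape is connected if, whenever it has more than one box, any two of its boxes are joined by a path of boxes in which consecutive boxes share an edge. A ribbon is a connected skew shape containing no $2\times 2$ square of boxes. For a ribbon $\alpha$, $\alpha^*$ denotes the ribbon obtained by rotating the diagram of $\alpha$ by $180$ degrees. A reverse plane partition of shape $\lambda/\mu$ is a filling of the boxes of the diagram with positive integers that weakly increase from left to right across rows and weakly increase from top to bottom down columns. Its monomial is $x^P=\prod_{i\ge 1} x_i^{m_i}$, where $m_i$ is the number of columns of $P$ that contain the integer $i$ as an entry. The dual stable Grothendieck polynomial is $g_{\lambda/\mu}=\sum_P x^P$, summed over all reverse plane partitions $P$ of shape $\lambda/\mu$; it is a formal power series (in fact a symmetric function) in $x_1,x_2,\ldots$. *)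

(* Defs.v *)
From HB Require Import structures.
From mathcomp Require Import all_boot all_order all_algebra finmap.
From mathcomp Require Import boolp classical_sets cardinality fsbigop.
From mathcomp.multinomials Require Import monalg.

Set Implicit Arguments.
Unset Strict Implicit.
Unset Printing Implicit Defensive.

Import Order.TTheory GRing.Theory Num.Theory.

Local Open Scope fset_scope.
Local Open Scope classical_set_scope.
Local Open Scope ring_scope.

Definition is_partition (la : seq nat) : bool := sorted geq la && (0%N \notin la).

Record skew_shape := SkewShape {
  outer : seq nat;
  inner : seq nat;
  outer_partition : is_partition outer;
  inner_partition : is_partition inner;
  inner_le_outer : forall i : nat, (nth 0 inner i <= nth 0 outer i)%N
}.

(* A box is (row, column), rows numbered from top to bottom and columns from
   left to right, both from 0; coordinates are integers so that diagrams can be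
   translated and rotated. *)
Definition box : Type := (int * int)%type.

Definition young_diagram (la : seq nat) : {fset box} :=
  [fset (i%:Z, j%:Z) | i in iota 0 (size la), j in iota 0 (nth 0%N la i)].

Definition diagram (s : skew_shape) : {fset box} :=
  (young_diagram (outer s) `\` young_diagram (inner s))%fset.

Definition translate (v : box) (D : {fset box}) : {fset box} :=
  [fset u + v | u in D].

Definition rot180 (D : {fset box}) : {fset box} := [fset - u | u in D].

Definition eq_up_to_translation (D E : {fset box}) : Prop :=
  exists v : box, D = translate v E.

Definition share_edge (u v : box) : bool :=
  `|u.1 - v.1| + `|u.2 - v.2| == 1.

Definition connected_diagram (D : {fset box}) : Prop :=
  forall u v : D, connect (fun x y : D => share_edge (val x) (val y)) u v.

Definition has_2x2_square (D : {fset box}) : Prop :=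
  exists i j : int, [/\ (i, j) \in D, (i, j + 1) \in D,
                        (i + 1, j) \in D & (i + 1, j + 1) \in D].

Definition ribbon (s : skew_shape) : Prop :=
  connected_diagram (diagram s) /\ ~ has_2x2_square (diagram s).

Definition reverse_plane_partition (D : {fset box}) (P : {ffun D -> nat}) : Prop :=
  [/\ forall u : D, (0 < P u)%N,
      forall u v : D, (val u).1 = (val v).1 -> (val u).2 <= (val v).2 ->
        (P u <= P v)%N
    & forall u v : D, (val u).2 = (val v).2 -> (val u).1 <= (val v).1 ->
        (P u <= P v)%N].

(* Number of columns of P containing i. *)
Definition column_mult (D : {fset box}) (P : {ffun D -> nat}) (i : nat) : nat :=
  #|` [fset (val u).2 | u : D & P u == i]|.

(* x^P; the index set covers all i with a nonzero exponent. *)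
Definition rpp_monomial (D : {fset box}) (P : {ffun D -> nat}) : {cmonom nat} :=
  [cmonom column_mult P i | i in [fset P u | u : D]]%M.

(* Formal power series in countably many variables, as coefficient functions
   on monomials. *)
Definition power_series (R : Type) : Type := {cmonom nat} -> R.

Definition series_monomial (m : {cmonom nat}) : power_series int :=
  fun m' => (m == m')%:R.

(* The infinite sum over reverse plane partitions is taken coefficientwise; by
   finite_rpp_monomial below, each coefficient is a finite sum (a \sum_(_ \in _)
   with infinite support would be 0). *)
Definition dual_stable_grothendieck (s : skew_shape) : power_series int :=
  fun m => \sum_(P \in [set P | @reverse_plane_partition (diagram s) P])
             series_monomial (rpp_monomial P) m.

Lemma rpp_monomialE (D : {fset box}) (P : {ffun D -> nat}) (i : nat) :
  rpp_monomial P i = column_mult P i.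
Proof.
rewrite /rpp_monomial cmE /= fsfun_fun; case: ifPn => // iNP.
apply/esym/eqP; rewrite cardfs_eq0; apply/eqP/fsetP => j; rewrite in_fset0.
apply/negP => /imfsetP[u /= + _]; rewrite inE => /eqP Pu.
by case/negP: iNP; rewrite -Pu; apply/imfsetP; exists u.
Qed.

Lemma finite_rpp_monomial (D : {fset box}) (m : {cmonom nat}) :
  finite_set [set P : {ffun D -> nat} | rpp_monomial P = m].
Proof.
pose N := (\max_(i <- finsupp m) i).+1.
pose F (Q : {ffun D -> 'I_N}) : {ffun D -> nat} := [ffun u => Q u : nat].
apply: (@sub_finite_set _ _ (F @` [set: {ffun D -> 'I_N}])); last first.
  by apply: finite_image; apply: finite_finset.
move=> P /= Pm.
have ltPN u : (P u < N)%N.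
  rewrite ltnS; apply: (@leq_bigmax_seq _ _ xpredT id) => //.
  rewrite mem_finsupp -Pm rpp_monomialE cardfs_eq0; apply/fset0Pn.
  by exists (val u).2; apply/imfsetP; exists u; rewrite //= inE.
exists [ffun u => Ordinal (ltPN u)] => //.
by apply/ffunP => u; rewrite !ffunE.
Qed.

Lemma in_diagram (s : skew_shape) (i j : nat) :
  ((i%:Z, j%:Z) \in diagram s) =
  (nth 0 (inner s) i <= j < nth 0 (outer s) i)%N.
Proof.
have memY (la : seq nat) :
    ((i%:Z, j%:Z) \in young_diagram la) = (j < nth 0 la i)%N.
  apply/imfset2P/idP => [[i' _ [j' /= + [-> ->]]]|ltj].
    by rewrite mem_iota.
  exists i; rewrite /= ?mem_iota ?add0n.
    by rewrite ltnNge; apply/negP => /(nth_default 0%N) la0; rewrite la0 in ltj.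
  by exists j; rewrite //= mem_iota.
by rewrite in_fsetD !memY -leqNgt.
Qed.

(* Main.v *)
From mathcomp Require Import all_boot all_order all_algebra finmap algC.
From mathcomp Require Import boolp classical_sets cardinality fsbigop.
From mathcomp Require Import zify ring lra.
From mathcomp.multinomials Require Import monalg.
Require Import Defs.

Set Implicit Arguments.
Unset Strict Implicit.
Unset Printing Implicit Defensive.

Import Order.TTheory GRing.Theory Num.Theory.

Local Open Scope fset_scope.
Local Open Scope classical_set_scope.
Local Open Scope ring_scope.

(** Walking along a ribbon from its bottom-left box to its top-right box turns
    the ribbon, up to translation, into a word of steps E and N, and rotating
    the ribbon by 180 degrees reverses the word.  A reverse plane partition is
    then a sequence of values that weakly rises along E and weakly falls along
    N; a value repeated along N sits in one column and is counted only once.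
    Let [fill w] be the generating function of these sequences in x_1, ..., x_n.
    Along N the values either agree or fall strictly, and a strict fall is the
    failure of a weak rise, so (fill_split)

      fill (p N q) = fill (p q) + fill p * fill q - fill (p E q).

    This recursion is stable under reversal of words, so fill (rev w) = fill w
    (fill_rev): a ribbon and its rotation have the same polynomial.

    For the converse, a word of k - 1 steps E gives the complete homogeneous
    polynomial h_k, and the recursion expresses every fill w through the h_k.
    Over an algebraically closed field h_1, ..., h_D can take arbitrary values
    (complete_prescribed), so an equality of two polynomials is an identity in
    independent unknowns h_k.  Let w have K steps E and b_j steps N in column j,
    for j = 0, ..., K.  Its part of lowest degree is h_(K+1), which yields K, and
    its parts of degrees K+2 and K+3 are explicit forms in the h_k whose
    coefficients are the b_j and the numbers of pairs of steps N (lin_part,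
    quad_part).  Suppose that b' has the same parts.  Reading off coefficients by
    polarization gives, with theta_j = b_j - b_(K-j),
      - b_j + b_(K-j) is the same for b' (column_pair_sum);
      - each partial sum of theta is the same for b' up to sign (energy_eq);
      - if i, j, k > 0 and i + j + k = K, then
        theta_i theta_j + theta_j theta_k + theta_i theta_k is the same for b'
        (a consequence of triple_relation).
    Consider phi = theta + theta' and psi = theta - theta'.  At each index one of
    phi, psi vanishes, and so does one of their partial sums; moreover
    phi (i + j) = phi i or psi (i + j) = psi j whenever phi i and psi j are
    nonzero.  Such a pair must have phi = 0 or psi = 0 (antisym_pair_rigid): the
    relations on products alone would allow psi to live on the multiples of a
    period of phi, and the partial sums exclude this.  Hence theta' = theta or
    theta' = - theta, that is, b' is b or its mirror image, and w' is w or its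
    reversal. *)

(** * The generating function of a word of steps *)

Section Transfer.

Variables (R : comNzRingType) (x : nat -> R) (n : nat).

(** The steps are [false] for east and [true] for north, the values range over
    1, ..., n, and [i] is the value of the first box.  In the north case the
    first summand is the case of equal values: both boxes then lie in one column
    and the factor [x i] must appear once, so it is left to the tail. *)
Fixpoint fill_from (w : seq bool) (i : nat) : R :=
  match w with
  | [::] => x i
  | true :: w' => fill_from w' i + x i * \sum_(1 <= j < i) fill_from w' j
  | false :: w' => x i * \sum_(i <= j < n.+1) fill_from w' j
  end.

Definition fill (w : seq bool) : R := \sum_(1 <= i < n.+1) fill_from w i.

(** A north step with distinct values is a strict fall, and a strict fall and a
    weak rise together impose no condition, so the two sides of the step become
    independent. *)
Lemma fill_from_cat p q i : (0 < i <= n)%N ->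
  fill_from (p ++ true :: q) i + fill_from (p ++ false :: q) i
  = fill_from (p ++ q) i + fill_from p i * fill q.
Proof.
elim: p i => [|u p IHp] i /andP[i0 iN].
  rewrite /= -addrA -mulrDr; congr (_ + _ * _).
  by rewrite -big_cat_nat //= ltnW.
have IHs m1 m2 : (0 < m1)%N -> (m2 <= n.+1)%N ->
    \sum_(m1 <= j < m2) fill_from (p ++ true :: q) j
      + \sum_(m1 <= j < m2) fill_from (p ++ false :: q) j
    = \sum_(m1 <= j < m2) fill_from (p ++ q) j
      + (\sum_(m1 <= j < m2) fill_from p j) * fill q.
  move=> lb ub; rewrite mulr_suml -!big_split /= !big_nat.
  by apply: eq_bigr => j /andP[? ?]; apply: IHp; lia.
case: u => /=; last first.
  by rewrite -mulrDr IHs // mulrDr mulrA.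
rewrite addrACA -mulrDr IHs //; last by lia.
rewrite IHp; last by lia.
ring.
Qed.

(** Each right-hand word is shorter, or as long with fewer north steps; hence this
    is a recursion that computes [fill] from the words without north steps. *)
Lemma fill_split p q :
  fill (p ++ true :: q) = fill (p ++ q) + fill p * fill q - fill (p ++ false :: q).
Proof.
apply/eqP; rewrite eq_sym subr_eq eq_sym; apply/eqP.
set Gq := fill q; rewrite /fill mulr_suml -!big_split /= big_nat [RHS]big_nat.
by apply: eq_bigr => i /andP[? ?]; apply: fill_from_cat; lia.
Qed.

(** Reversal exchanges the roles of [p] and [q] in [fill_split] and fixes the
    words without north steps. *)
Lemma fill_rev w : fill (rev w) = fill w.
Proof.
(* Both p E q and the shorter words in fill_split decrease this measure. *)
have [m] := ubnP (size w + count id w); elim: m w => // m IHm w.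
rewrite ltnS => le_m; case: (boolP (true \in w)) => [wT|wF]; last first.
  suff -> : w = nseq (size w) false.
    congr fill; elim: (size w) => //= k IHk.
    by rewrite rev_cons IHk -cats1 -(nseqD k 1) addn1.
  apply/all_pred1P/allP => u uw; case: u uw => //= uw.
  by rewrite uw in wF.
case: (path.splitPr wT) le_m => p q.
rewrite rev_cat rev_cons cat_rcons !fill_split.
rewrite size_cat count_cat /= => le_m.
rewrite -cat_rcons -rev_cons -!rev_cat !IHm ?size_cat ?count_cat /=; try by lia.
ring.
Qed.

End Transfer.

Notation east := (count negb).

(** Number of north steps in column [j], columns being numbered from 0 at the
    left: the column changes at each east step. *)
Fixpoint north (w : seq bool) (j : nat) : nat :=
  match w with
  | [::] => 0
  | true :: w' => (j == 0) + north w' j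
  | false :: w' => if j is j'.+1 then north w' j' else 0
  end.

Lemma north_cat p q j : north (p ++ q) j =
  (north p j + (if east p <= j then north q (j - east p) else 0))%N.
Proof.
elim: p j => [|[] p IHp] j /=; first by rewrite subn0.
  by rewrite IHp addnA.
by case: j => [|j] //; rewrite IHp.
Qed.

Lemma north_out w j : (east w < j)%N -> north w j = 0%N.
Proof.
elim: w j => [|[] w IHw] [|j] //=; last by apply: IHw.
by move=> ?; rewrite IHw.
Qed.

Lemma north_rev w j : (j <= east w)%N -> north (rev w) j = north w (east w - j).
Proof.
elim: w j => [|[] w IHw] j //= jw; rewrite rev_cons -cats1 north_cat count_rev /=.
  case: ltngtP jw => // [lt|->] _.
    by rewrite IHw ?addn0 ?(ltnW lt) //; have -> : (east w - j == 0)%N = false by lia.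
  by rewrite IHw // subnn addnC.
move: jw; case: (ltngtP j (east w)) => [lt|gt|->] jw.
- by rewrite addn0 IHw ?(ltnW lt) // add1n subSn ?(ltnW lt).
- rewrite north_out ?count_rev // add0n (_ : j - east w = 1)%N; last by lia.
  by rewrite (_ : 1 + east w - j = 0)%N //; lia.
- by rewrite subnn addn0 IHw // subnn add1n subSnn.
Qed.

Lemma north_inj w w' : east w = east w' ->
  (forall j, (j <= east w)%N -> north w j = north w' j) -> w = w'.
Proof.
elim: w w' => [|[] w IHw] [|[] w'] //=.
- by move=> _ /(_ 0%N isT).
- by move=> _ /(_ 0%N isT).
- move=> eqE eqN; congr cons; apply: IHw => // j jw.
  by have := eqN j jw; lia.
- by move=> eqE /(_ 0%N isT).
- by move=> eqE /(_ 0%N isT).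
- move=> [eqE] eqN; congr cons; apply: IHw => // j jw.
  by apply: (eqN j.+1).
Qed.

(** * Homogeneous parts of low degree *)

(** Number of pairs of north steps that lie in the columns [i] and [j]. *)
Definition pair_count (b : nat -> nat) (i j : nat) : nat :=
  if i == j then 'C(b j, 2) else (b i * b j)%N.

(** Each term is the generating function of a word in which one north step, in
    column [j], is a strict fall and all other steps are weak rises: a ribbon
    Schur function with two rows, expanded in the [h].  The index [i] counts
    additional east steps in front of the word; it makes induction on the word
    possible. *)
Definition lin_part (R : comNzRingType) (h : nat -> R) (i K : nat) (b : nat -> nat) : R :=
  \sum_(j < K.+1) (b j)%:R * (h (i + j).+1 * h (K - j).+1 - h (i + K).+2).

(** As for [lin_part], with two strict falls: the terms are ribbon Schur
    functions with three rows. *)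
Definition quad_part (R : comNzRingType) (h : nat -> R) (i K : nat)
    (b : nat -> nat) : R :=
  \sum_(k < K.+1) \sum_(j < K.+1 | (j <= k)%N) (pair_count b j k)%:R *
    (h (i + j).+1 * h (k - j).+1 * h (K - k).+1
     - h (i + k).+2 * h (K - k).+1 - h (i + j).+1 * h (K - j).+2
     + h (i + K).+3).

Lemma lin_part_east (F : comNzRingType) (h : nat -> F) i K w :
  lin_part h i K.+1 (north (false :: w)) = lin_part h i.+1 K (north w).
Proof.
rewrite /lin_part big_ord_recl /= mul0r add0r; apply: eq_bigr => j _.
by rewrite /bump /= subSS add1n addnS addSn addnS.
Qed.

(** A north step in front of the word joins column 0. *)
Lemma lin_part_north (F : comNzRingType) (h : nat -> F) i K w :
  lin_part h i K (north (true :: w))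
  = lin_part h i K (north w) + (h i.+1 * h K.+1 - h (i + K).+2).
Proof.
rewrite /lin_part !big_ord_recl /= natrD !addn0 subn0.
under eq_bigr do rewrite add0n.
ring.
Qed.

Lemma quad_part_east (F : comNzRingType) (h : nat -> F) i K w :
  quad_part h i K.+1 (north (false :: w)) = quad_part h i.+1 K (north w).
Proof.
rewrite /quad_part big_ord_recl /= big1 ?add0r => [|j j0]; last first.
  by rewrite /pair_count; case: eqP; rewrite ?mul0r // muln0 mul0r.
apply: eq_bigr => k _; rewrite big_mkcond big_ord_recl /= {1}/pair_count /=.
rewrite mul0n mul0r add0r [RHS]big_mkcond; apply: eq_bigr => j _.
rewrite /bump /= !add1n ltnS; case: leqP => // jk.
by rewrite !subSS !addnS !addSn.
Qed.

Lemma pair_count_north w j k : (j <= k)%N ->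
  pair_count (north (true :: w)) j k
  = (pair_count (north w) j k + (j == 0) * north w k)%N.
Proof.
move=> jk; rewrite /pair_count /=; case: eqP => [->|/eqP ne].
  by case: k {jk} => [|k] /=; rewrite ?binS ?bin1 ?mul1n ?add0n ?mul0n ?addn0.
case: k ne jk => [|k] ne jk; first by move: jk ne; case: j.
by rewrite add0n mulnDl addnC.
Qed.

(** The north step added in front forms one more pair with each north step of
    [w]; the sum over these pairs factors through [lin_part]. *)
Lemma quad_part_north (F : comNzRingType) (h : nat -> F) i K w :
  quad_part h i K (north (true :: w)) = quad_part h i K (north w)
    + h i.+1 * lin_part h 0 K (north w) - lin_part h i.+1 K (north w).
Proof.
rewrite -addrA /lin_part mulr_sumr -sumrB /quad_part -big_split /=.
apply: eq_bigr => k _.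
under eq_bigr => j jk do
  rewrite pair_count_north // natrD mulrDl.
rewrite big_split /=; congr (_ + _).
rewrite big_mkcond big_ord_recl /= mul1n big1 ?addr0 => [|j _]; last first.
  by case: ifP; rewrite ?mul0n ?mul0r.
rewrite !addn0 !subn0 add0n !addSn; ring.
Qed.

Section LowDegree.

Variables (F : comNzRingType) (x : nat -> {poly F}) (n : nat) (h : nat -> F).
Hypothesis fill_east :
  forall k, fill x n (nseq k false) = h k.+1 *: 'X^(k.+1).

Let shifted_coef i w m : (fill x n (nseq i false) * fill x n w)`_(i + m).+1
  = h i.+1 * (fill x n w)`_m.
Proof.
rewrite fill_east -scalerAl coefZ coefXnM -addSn ltnNge leq_addr /=.
by rewrite addKn.
Qed.

Let nseq_east i w : nseq i false ++ false :: w = nseq i.+1 false ++ w.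
Proof. by rewrite -cat_rcons -cats1 -(nseqD i 1) addn1. Qed.

(** Every column contributes at least one variable. *)
Lemma fill_coef_low i w m : (m <= i + east w)%N ->
  (fill x n (nseq i false ++ w))`_m = 0.
Proof.
elim: w i m => [|[] w IHw] i m /= le_m; last first.
- by rewrite nseq_east IHw //; lia.
- rewrite fill_split nseq_east coefB coefD !IHw; try by lia.
  rewrite add0r subr0; have [le_mi|lt_im] := leqP m i; last first.
    have [d mE] : exists d, m = (i + d).+1 by exists (m - i.+1)%N; lia.
    by rewrite mE shifted_coef (IHw 0%N) ?mulr0 //; lia.
  rewrite fill_east -scalerAl coefZ coefXnM; case: ltnP; rewrite ?mulr0 //; lia.
- by rewrite cats0 fill_east coefZ coefXn; case: eqP; rewrite ?mulr0 //; lia.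
Qed.

(** In the lowest degree every column is constant. *)
Lemma fill_coef0 i w :
  (fill x n (nseq i false ++ w))`_(i + east w).+1 = h (i + east w).+1.
Proof.
elim: w i => [|[] w IHw] i /=.
- by rewrite cats0 addn0 fill_east coefZ coefXn eqxx mulr1.
- rewrite add0n fill_split nseq_east coefB coefD IHw shifted_coef.
  by rewrite (@fill_coef_low 0) // mulr0 addr0 fill_coef_low ?subr0 ?addSn.
- by rewrite nseq_east add1n addnS -addSn IHw.
Qed.

Lemma fill_coef1 i w : (fill x n (nseq i false ++ w))`_(i + east w).+2
  = lin_part h i (east w) (north w).
Proof.
elim: w i => [|[] w IHw] i.
- rewrite /lin_part big1 => [|j _]; last by rewrite mul0r.
  by rewrite cats0 addn0 fill_east coefZ coefXn -[_ == _]/(i.+2 == i.+1)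
    gtn_eqF ?mulr0.
- rewrite lin_part_north [east _]/= add0n fill_split nseq_east coefB coefD IHw.
  by rewrite -addnS shifted_coef (fill_coef0 0) addnS -addSn fill_coef0 addrA.
- by rewrite [east _]/= add1n lin_part_east nseq_east addnS -addSn IHw.
Qed.

Lemma fill_coef2 i w : (fill x n (nseq i false ++ w))`_(i + east w).+3
  = quad_part h i (east w) (north w).
Proof.
elim: w i => [|[] w IHw] i.
- rewrite /quad_part big1 => [|k _]; last first.
    rewrite big1 // => j _; rewrite /pair_count.
    by case: ifP; rewrite ?mul0n mul0r.
  by rewrite cats0 addn0 fill_east coefZ coefXn -[_ == _]/(i.+3 == i.+1)
    gtn_eqF ?mulr0.
- rewrite quad_part_north [east _]/= add0n fill_split nseq_east coefB coefD IHw.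
  by rewrite -2!addnS shifted_coef (fill_coef1 0) !addnS -addSn fill_coef1.
- by rewrite [east _]/= add1n quad_part_east nseq_east addnS -addSn IHw.
Qed.

End LowDegree.

(** * Prescribing the complete homogeneous symmetric polynomials *)

Section CompleteHomogeneous.

Variables (F : comNzRingType) (y : nat -> F) (n : nat).

(** The complete homogeneous polynomial of degree [m] in the variables
    [y i], ..., [y n]. *)
Definition complete_from (i m : nat) : F :=
  if m is m'.+1 then \sum_(i <= j < n.+1) fill_from y n (nseq m' false) j else 1.

Lemma fill_from_east m i :
  fill_from y n (nseq m false) i = y i * complete_from i m.
Proof. by case: m => [|m] //=; rewrite mulr1. Qed.

Lemma complete_from_step i m : (i <= n)%N ->
  complete_from i m.+1 = y i * complete_from i m + complete_from i.+1 m.+1.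
Proof. by move=> iN; rewrite /= big_ltn // fill_from_east. Qed.

Lemma coefM_congr D (p q r : {poly F}) :
  (forall m, (m <= D)%N -> p`_m = q`_m) ->
  forall m, (m <= D)%N -> (r * p)`_m = (r * q)`_m.
Proof.
move=> pq m mD; rewrite !coefM; apply: eq_bigr => j _; rewrite pq //.
by rewrite (leq_trans (leq_subr _ _)).
Qed.

(** The classical generating function: truncated at degree [D], the series of the
    complete homogeneous polynomials is inverse to the product of the
    [1 - y j X]. *)
Lemma prod_complete_from D m : (m <= D)%N ->
  (\prod_(1 <= j < n.+1) (1 - y j *: 'X) *
     \poly_(k < D.+1) complete_from 1 k)`_m = (m == 0%N)%:R.
Proof.
suff H d : (d <= n)%N -> forall m, (m <= D)%N ->
    (\prod_(n.+1 - d <= j < n.+1) (1 - y j *: 'X) *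
       \poly_(k < D.+1) complete_from (n.+1 - d) k)`_m = (m == 0%N)%:R.
  by have := H n (leqnn n) m; rewrite subSn // subnn.
elim: d => [|d IHd] dn {}m mD.
  rewrite subn0 big_geq // mul1r coef_poly ltnS mD.
  by case: m {mD} => //= m; rewrite big_geq.
rewrite subSS -(IHd (ltnW dn) m mD) subSn ?(ltnW dn) //.
have cE i' k : (k <= D)%N ->
    (\poly_(k < D.+1) complete_from i' k)`_k = complete_from i' k.
  by move=> kD; rewrite coef_poly ltnS kD.
set i := (n - d)%N; rewrite big_ltn ?ltnS ?leq_subr // mulrC mulrA mulrC.
apply: (@coefM_congr D _ _ _ _ m mD) => {mD}m mD.
rewrite mulrBr mulr1 -scalerAr coefB coefZ coefMX.
transitivity (complete_from i m -
    y i * (if m == 0%N then 0 else complete_from i m.-1)).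
  by case: m mD => [|m] mD; congr (_ - _ * _); apply: cE; rewrite // ltnW.
rewrite [RHS]cE //; case: m {mD} => [|m]; first by rewrite mulr0 subr0.
by rewrite complete_from_step ?leq_subr //= addrAC subrr add0r.
Qed.

End CompleteHomogeneous.

Lemma fill_east_scale (F : comNzRingType) (y : nat -> F) n m :
  fill (fun i => y i *: 'X) n (nseq m false)
  = fill y n (nseq m false) *: 'X^(m.+1).
Proof.
suff E i : fill_from (fun i => y i *: 'X) n (nseq m false) i
    = fill_from y n (nseq m false) i *: 'X^(m.+1).
  by rewrite /fill scaler_suml; apply: eq_bigr.
elim: m i => [|m IHm] i //=; under eq_bigr do rewrite IHm.
by rewrite -scaler_suml -scalerAl -scalerAr scalerA -exprS.
Qed.

(** A truncated geometric series in [1 - p]. *)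
Lemma inverse_mod_Xn (F : comNzRingType) (p : {poly F}) D : p`_0 = 1 ->
  exists2 q : {poly F}, q`_0 = 1 & forall m, (m <= D)%N ->
    (p * q)`_m = (m == 0%N)%:R.
Proof.
move=> p0; pose u := 1 - p.
have u0 : u`_0 = 0 by rewrite /u coefB coef1 p0 subrr.
have uX k : exists v, u ^+ k = v * 'X^k.
  have [v vE] : exists v, u = v * 'X.
    exists (\poly_(i < size u) u`_i.+1); apply/polyP => -[|i].
      by rewrite u0 coefMX.
    rewrite coefMX coef_poly; case: ltnP => //= le_i.
    by rewrite nth_default // ltnW.
  by exists (v ^+ k); rewrite vE exprMn_comm //; apply: mulrC.
exists (\sum_(i < D.+1) u ^+ i) => [|m mD].
  rewrite coef_sum big_ord_recl expr0 coef1 big1 ?addr0 // => i _.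
  by have [v ->] := uX (bump 0 i); rewrite coefMXn.
have -> : p * (\sum_(i < D.+1) u ^+ i) = 1 - u ^+ D.+1.
  rewrite -[RHS]opprB subrX1 -mulNr opprB; congr (_ * _).
  by rewrite /u opprB addrC subrK.
have [v ->] := uX D.+1.
by rewrite coefB coef1 coefMXn ltnS mD subr0.
Qed.

(** The inverse [Q] of the series with coefficients [c] splits into linear factors
    [1 - y X]; the inverses [y] of the roots of [Q] are the required values. *)
Lemma complete_prescribed (F : closedFieldType) (c : nat -> F) D :
  exists n (y : nat -> F), forall k, (k < D)%N ->
    fill y n (nseq k false) = c k.+1.
Proof.
pose C := \poly_(k < D.+1) (if k is 0 then 1 else c k).
have C0 : C`_0 = 1 by rewrite coef_poly.
have [Q Q0 CQ] := inverse_mod_Xn D C0.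
have [r Qr] := closed_field_poly_normal Q.
have r0 z : z \in r -> z != 0.
  move=> zr; apply/eqP => z0; have Qz : Q.[z] = 0.
    by rewrite Qr hornerZ (rootP _) ?mulr0 // root_prod_XsubC.
  by move/eqP: Qz; rewrite z0 horner_coef0 Q0 oner_eq0.
pose y j := (nth 0 r j.-1)^-1.
have QE : Q = \prod_(1 <= j < (size r).+1) (1 - y j *: 'X).
  have prodE : \prod_(1 <= j < (size r).+1) (1 - y j *: 'X)
      = \prod_(z <- r) (1 - z^-1 *: 'X).
    by rewrite big_add1 /= [RHS](big_nth 0).
  rewrite prodE; pose a := lead_coef Q * \prod_(z <- r) (- z).
  have Qa : Q = a *: \prod_(z <- r) (1 - z^-1 *: 'X).
    rewrite {1}Qr /a -scalerA; congr (_ *: _).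
    rewrite -scaler_prod; apply: eq_big_seq => z /r0 z0.
    by rewrite scalerBr scalerA mulNr mulfV // scaleN1r opprK scaleNr addrC alg_polyC.
  rewrite {1}Qa; suff -> : a = 1 by rewrite scale1r.
  rewrite -Q0 Qa coefZ -horner_coef0 horner_prod big1 ?mulr1 // => z _.
  by rewrite !hornerE ?mulr0 ?subr0.
exists (size r), y => k kD.
have H m : (m <= D)%N -> complete_from y (size r) 1 m = C`_m.
  move=> mD; pose H := \poly_(k < D.+1) complete_from y (size r) 1 k.
  have -> : complete_from y (size r) 1 m = H`_m by rewrite coef_poly ltnS mD.
  have low (p q : {poly F}) : (forall m, (m <= D)%N -> (p * q)`_m = (m == 0%N)%:R) ->
      forall g, (g * (p * q))`_m = g`_m.
    move=> pq g; rewrite (@coefM_congr _ D _ 1 g _ m mD) ?mulr1 // => i iD.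
    by rewrite pq // coef1.
  rewrite -(low C Q CQ H) mulrCA [H * Q]mulrC (low Q H) // => i iD.
  by rewrite QE prod_complete_from.
by have := H k.+1 kD; rewrite coef_poly ltnS kD.
Qed.

(** * A rigidity property of pairs of antisymmetric sequences *)

Section Rigidity.

Variables (K : nat) (phi psi : nat -> int).
Hypotheses (phiN : forall a, (a <= K)%N -> phi (K - a)%N = - phi a).
Hypotheses (psiN : forall a, (a <= K)%N -> psi (K - a)%N = - psi a).
Hypothesis disj : forall a, (a <= K)%N -> phi a != 0 -> psi a = 0.
Hypothesis sum_disj : forall m, (m <= K.+1)%N ->
  (\sum_(i < m) phi i) * (\sum_(i < m) psi i) = 0.
Hypothesis absorb : forall a b, (a + b <= K)%N -> phi a != 0 -> psi b != 0 ->
  phi (a + b)%N = phi a \/ psi (a + b)%N = psi b.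

(** The hypothesis [absorb] applied to [a] and [K - r], then reflected. *)
Lemma reflect_or a r : (a <= r <= K)%N -> phi a != 0 -> psi r != 0 ->
  phi (r - a)%N = - phi a \/ psi (r - a)%N = psi r.
Proof.
move=> /andP[ar rK] pa pr.
have Kr : psi (K - r)%N != 0 by rewrite psiN // oppr_eq0.
have le : (a + (K - r) <= K)%N by lia.
have E : (r - a = K - (a + (K - r)))%N by lia.
case: (absorb le pa Kr) => H; [left|right]; rewrite E ?phiN ?psiN // H //.
by rewrite psiN // opprK.
Qed.

(** The smallest element [b0] of the support of [psi] forces [phi] to be
    antisymmetric on the open interval from 0 to [b0], so the partial sums of
    [phi] and [psi] up to [b0] are [phi 0] and [psi b0].  Hence [phi 0 = 0].
    After [b0] the partial sum of [psi] is nonzero, so the next support element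
    [r] must again belong to [psi].  Now [b0] and [r] both reflect [phi], and
    composing the two reflections translates the support of [phi] below [b0] by
    [r - b0], which is at most [a0], with the same values.  Following a value
    [phi a0] up to the last place below [b0] where it occurs contradicts
    [phi (b0 - a0) = - phi a0]. *)
Lemma no_interleaving a0 b0 : (a0 < b0 <= K)%N ->
  phi a0 != 0 -> (forall a, (a < a0)%N -> phi a = 0) ->
  psi b0 != 0 -> (forall b, (b < b0)%N -> psi b = 0) -> False.
Proof.
move=> /andP[ab bK] pa0 mina pb0 minb.
have phib0 : phi b0 = 0.
  by apply/eqP/negP => /negP /(disj bK) /eqP; rewrite (negPf pb0).
have refl0 a : (0 < a <= b0)%N -> phi a != 0 -> phi (b0 - a)%N = - phi a.
  move=> /andP[a_gt0 le_ab] pa.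
  have [|//|H] := @reflect_or a b0 _ pa pb0; first by rewrite le_ab.
  by move: pb0; rewrite -H minb ?eqxx //; lia.
have refl a : (0 < a < b0)%N -> phi (b0 - a)%N = - phi a.
  move=> /andP[a_gt0 lt_ab].
  have [pa|pa] := eqVneq (phi a) 0; last by apply: refl0; lia.
  rewrite pa oppr0; apply/eqP/negP => /negP pa'.
  have := refl0 (b0 - a)%N; rewrite (_ : b0 - (b0 - a) = a)%N; last by lia.
  by move=> /(_ _ pa') H; move: pa'; rewrite -oppr_eq0 -H ?pa ?eqxx //; lia.
have sum_psi : \sum_(i < b0.+1) psi i = psi b0.
  by rewrite big_ord_recr /= big1 ?add0r // => i _; apply: minb.
have sum_phi : \sum_(i < b0.+1) phi i = phi 0%N.
  have b0_gt0 : (0 < b0)%N by lia.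
  rewrite big_ord_recr /= phib0 addr0 -(big_mkord xpredT) big_ltn //.
  set s := \sum_(_ <= _ < _) _.
  suff : s = - s by move=> sN; rewrite (_ : s = 0) ?addr0 //; lia.
  rewrite {1}/s big_nat_rev /= -sumrN [in RHS]big_nat_cond [in LHS]big_nat_cond.
  apply: eq_bigr => i /andP[/andP[i_gt0 lt_i] _].
  by rewrite -refl; [congr phi; lia | lia].
have phi0 : phi 0%N = 0.
  apply/eqP; have /eqP := @sum_disj b0.+1 bK.
  by rewrite sum_phi sum_psi mulf_eq0 (negPf pb0) orbF.
have a0_gt0 : (0 < a0)%N by case: (a0) pa0; rewrite ?phi0 ?eqxx.
have Kb0 : (a0 + b0 <= K)%N.
  rewrite leqNgt; apply/negP => lt.
  suff /eqP : psi (K - b0)%N = 0 by rewrite psiN // oppr_eq0 (negPf pb0).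
  by apply: minb; lia.
(* The support has an element after b0, because absorb applies to a0 and b0. *)
have /ex_minnP[r] : exists r, (b0 < r <= K)%N && ((phi r != 0) || (psi r != 0)).
  exists (a0 + b0)%N; rewrite Kb0 -{1}[b0]add0n ltn_add2r a0_gt0 /=.
  by case: (absorb Kb0 pa0 pb0) => ->; rewrite ?pa0 ?pb0 ?orbT.
move=> /andP[/andP[b0r rK] r_supp] minr.
have le_r : (r <= a0 + b0)%N.
  apply: minr; rewrite Kb0 -{1}[b0]add0n ltn_add2r a0_gt0 /=.
  by case: (absorb Kb0 pa0 pb0) => ->; rewrite ?pa0 ?pb0 ?orbT.
have gap i : (b0 < i < r)%N -> phi i = 0 /\ psi i = 0.
  move=> lt_i; have : ~~ ((phi i != 0) || (psi i != 0)).
    by apply/negP => H; have := minr i; rewrite H andbT => /(_ _); lia.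
  by rewrite negb_or !negbK => /andP[/eqP-> /eqP->].
have sum_r (h : nat -> int) : (forall i, (b0 < i < r)%N -> h i = 0) ->
    \sum_(i < r.+1) h i = \sum_(i < b0.+1) h i + h r.
  move=> h0; rewrite big_ord_recr /= -!(big_mkord xpredT).
  rewrite (@big_cat_nat _ _ _ b0.+1) //= [X in _ + X + _]big_nat_cond.
  by rewrite [X in _ + X + _]big1 ?addr0 // => i /andP[/h0].
(* At r + 1 both partial sums would be nonzero if phi r were nonzero. *)
have psir : psi r != 0.
  case: (eqVneq (phi r) 0) r_supp => [_ //|pr _].
  have /eqP := @sum_disj r.+1 rK; rewrite !sum_r => [|i /gap[]|i /gap[]] //.
  rewrite sum_phi sum_psi phi0 add0r (disj rK pr) addr0.
  by rewrite mulf_eq0 (negPf pr) (negPf pb0).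
pose e := (r - b0)%N.
(* The reflection in b0 followed by the reflection in r. *)
have shift s : (s < b0 - e)%N -> phi s != 0 -> phi (s + e)%N = phi s.
  move=> lt_s ps; have s_gt0 : (0 < s)%N by case: (s) ps; rewrite ?phi0 ?eqxx.
  have le_b : phi (b0 - s)%N = - phi s by rewrite refl //; lia.
  have pbs : phi (b0 - s)%N != 0 by rewrite le_b oppr_eq0.
  have rE : (r - (b0 - s) = s + e)%N by rewrite /e; lia.
  have [||H] := @reflect_or (b0 - s) r _ pbs psir; rewrite ?rE.
  - by rewrite rK andbT; lia.
  - by rewrite le_b opprK.
  - by move: psir; rewrite -H rE minb ?eqxx //; lia.
pose low s := (s < b0)%N && (phi s == phi a0).
have low_a0 : exists s, low s by exists a0; rewrite /low ab eqxx.
have low_ub s : low s -> (s <= b0)%N by case/andP => /ltnW.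
have [s /andP[lt_s /eqP ps] maxs] := ex_maxnP low_a0 low_ub.
have s_nz : phi s != 0 by rewrite ps.
have s_gt0 : (0 < s)%N by case: (s) s_nz; rewrite ?phi0 ?eqxx.
have le_s : (s <= b0 - a0)%N.
  rewrite leqNgt; apply/negP => lt.
  move: s_nz; rewrite -oppr_eq0 -refl ?mina ?eqxx //; lia.
(* Below b0 - e the place s could be shifted further, against its maximality. *)
case: (leqP (b0 - e) s); last first.
  move=> lt_se; have := maxs (s + e)%N; rewrite /low shift // ps eqxx andbT.
  by rewrite /e in lt_se *; move=> /(_ _); lia.
move=> ge_s; have sE : s = (b0 - a0)%N by rewrite /e in ge_s; lia.
move: ps; rewrite sE refl //; last by lia.
by move/eqP; rewrite -subr_eq0 -opprD oppr_eq0 -mulr2n mulrn_eq0 (negPf pa0).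
Qed.

End Rigidity.

(** If neither sequence vanishes, their supports have distinct smallest elements,
    and the hypotheses are symmetric in the two sequences. *)
Lemma antisym_pair_rigid K (phi psi : nat -> int) :
  (forall a, (a <= K)%N -> phi (K - a)%N = - phi a) ->
  (forall a, (a <= K)%N -> psi (K - a)%N = - psi a) ->
  (forall a, (a <= K)%N -> phi a * psi a = 0) ->
  (forall m, (m <= K.+1)%N ->
    (\sum_(i < m) phi i) * (\sum_(i < m) psi i) = 0) ->
  (forall a b, (a + b <= K)%N -> phi a != 0 -> psi b != 0 ->
    phi (a + b)%N = phi a \/ psi (a + b)%N = psi b) ->
  (forall a, (a <= K)%N -> phi a = 0) \/ (forall a, (a <= K)%N -> psi a = 0).
Proof.
move=> phiN psiN disj sumd abs.
have wit (h : nat -> int) : (forall a, (a <= K)%N -> h a = 0) \/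
    exists2 a0, (a0 <= K)%N /\ h a0 != 0 & forall a, (a < a0)%N -> h a = 0.
  case: (boolP [exists a : 'I_K.+1, h a != 0]) => [/existsP[a ha]|/existsPn h0].
    right; have /ex_minnP[m /andP[mK hm] minm] :
      exists m, (m <= K)%N && (h m != 0) by exists a; rewrite -ltnS ltn_ord.
    exists m => // i lt_i; apply/eqP; rewrite -[_ == _]negbK; apply/negP => hi.
    by have := minm i; rewrite hi andbT => /(_ _); lia.
  by left=> a aK; have := h0 (Ordinal (aK : (a < K.+1)%N)); rewrite negbK => /eqP.
have [|[a0 [a0K pa0] mina]] := wit phi; first by left.
have [|[b0 [b0K pb0] minb]] := wit psi; first by right.
exfalso; case: (ltngtP a0 b0) => [lt|lt|eq].
- apply: (@no_interleaving K phi psi _ _ _ _ _ a0 b0) => //; last by rewrite lt.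
  by move=> a /disj /eqP; rewrite mulf_eq0 => /orP[/eqP->|/eqP//]; rewrite eqxx.
- apply: (@no_interleaving K psi phi _ _ _ _ _ b0 a0) => //; last by rewrite lt.
  + by move=> a /disj /eqP; rewrite mulf_eq0 => /orP[/eqP//|/eqP->]; rewrite eqxx.
  + by move=> m mK; rewrite mulrC sumd.
  + by move=> a b le ha hb; case: (@abs b a); rewrite ?[(b + a)%N]addnC; auto.
- have := disj _ a0K; move: pb0; rewrite -eq => pb0 /eqP.
  by rewrite mulf_eq0 (negPf pa0) (negPf pb0).
Qed.

(** * Recovering the north steps of each column *)

Section Polarization.

Variables (F : comNzRingType) (I : finType) (P : pred I) (d : I -> F).

Definition unit_seq (u n : nat) : F := (n == u)%:R.

(** Evaluation at sums of unit sequences extracts the coefficient of a monomial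
    in the unknowns [c]. *)
Lemma polarize2 (x y : I -> nat) :
  (forall c : nat -> F, \sum_(i | P i) d i * (c (x i) * c (y i)) = 0) ->
  forall u v, \sum_(i | P i) d i *+ ((x i == u) && (y i == v))
            + \sum_(i | P i) d i *+ ((x i == v) && (y i == u)) = 0.
Proof.
move=> T u v; pose eu := unit_seq u; pose ev := unit_seq v.
have := T (fun n => eu n + ev n).
rewrite (eq_bigr (fun i => d i * (eu (x i) * eu (y i))
  + d i * (ev (x i) * ev (y i)) + (d i *+ ((x i == u) && (y i == v))
    + d i *+ ((x i == v) && (y i == u))))) => [|i _]; last first.
  rewrite -!mulnb -![d i *+ _]mulr_natr !natrM.
  rewrite -/(unit_seq u (x i)) -/(unit_seq v (x i)).
  by rewrite -/(unit_seq u (y i)) -/(unit_seq v (y i)) /eu /ev; ring.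
by rewrite !big_split /= !T !add0r.
Qed.

Lemma polarize3 (x y z : I -> nat) :
  (forall c : nat -> F,
     \sum_(i | P i) d i * (c (x i) * c (y i) * c (z i)) = 0) ->
  let at_ u v t :=
    \sum_(i | P i) d i *+ [&& x i == u, y i == v & z i == t] in
  forall u v t, at_ u v t + at_ u t v + at_ v u t + at_ v t u
              + at_ t u v + at_ t v u = 0.
Proof.
move=> T at_ u v t.
pose eu := unit_seq u; pose ev := unit_seq v; pose et := unit_seq t.
pose term (c : nat -> F) i := d i * (c (x i) * c (y i) * c (z i)).
have TT (c : nat -> F) : \sum_(i | P i) term c i = 0 by apply: T.
rewrite /at_ -!big_split /=.
rewrite (eq_bigr (fun i => term (fun n => eu n + ev n + et n) i
  + term eu i + term ev i + term et i
  - term (fun n => eu n + ev n) i - term (fun n => eu n + et n) i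
  - term (fun n => ev n + et n) i)) => [|i _]; last first.
  rewrite -!mulnb -![d i *+ _]mulr_natr !natrM.
  rewrite -/(unit_seq u (x i)) -/(unit_seq v (x i)) -/(unit_seq t (x i)).
  rewrite -/(unit_seq u (y i)) -/(unit_seq v (y i)) -/(unit_seq t (y i)).
  rewrite -/(unit_seq u (z i)) -/(unit_seq v (z i)) -/(unit_seq t (z i)).
  by rewrite /term /eu /ev /et; ring.
by rewrite !sumrB !big_split /= !TT !addr0 !subr0.
Qed.

End Polarization.

Lemma sum_pick (V : nmodType) (I : finType) (P Q : pred I) (d : I -> V) a :
  P a -> (forall i, P i -> Q i = (i == a)) -> \sum_(i | P i) d i *+ Q i = d a.
Proof.
move=> Pa QE; rewrite (bigD1 a) //= QE // eqxx mulr1n big1 ?addr0 // => i.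
by case/andP => Pi /negPf ia; rewrite QE // ia mulr0n.
Qed.

Lemma sum_pick0 (V : nmodType) (I : finType) (P Q : pred I) (d : I -> V) :
  (forall i, P i -> Q i = false) -> \sum_(i | P i) d i *+ Q i = 0.
Proof. by move=> QE; rewrite big1 // => i Pi; rewrite QE // mulr0n. Qed.

Section Coefficients.

Variables (F : numDomainType) (K : nat) (b b' : nat -> nat).
Hypothesis lin_eq : forall h : nat -> F, lin_part h 0 K b = lin_part h 0 K b'.
Hypothesis quad_eq : forall h : nat -> F,
  quad_part h 0 K b = quad_part h 0 K b'.

Let mirror (f : nat -> nat) i := f (K - i)%N.
Let psum (f : nat -> nat) m : int := \sum_(i < m) (f i)%:Z.
Let dpair i j : int := (pair_count b i j)%:Z - (pair_count b' i j)%:Z.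

(** The coefficient of h_(a+1) h_(K-a+1) in the linear part. *)
Lemma column_pair_sum a : (a <= K)%N -> (b a + b (K - a) = b' a + b' (K - a))%N.
Proof.
move=> aK.
pose d (j : 'I_K.+1) : F := ((b j)%:Z - (b' j)%:Z)%:~R.
have T (c : nat -> F) :
    \sum_(j < K.+1) d j * (c j.+1 * c (K - j).+1) = 0.
  (* Killing h_(K+2) removes the term that is linear in the unknowns. *)
  pose h n := if n == K.+2 then 0 else c n.
  have /eqP := lin_eq h; rewrite -subr_eq0 /lin_part -sumrB => /eqP {2}<-.
  apply: eq_bigr => j _; rewrite /h !add0n eqxx subr0.
  rewrite !ifF; try by apply/eqP; have := ltn_ord j; lia.
  by rewrite /d rmorphB /= mulrBl.
have lta : (a < K.+1)%N by [].
have ltKa : (K - a < K.+1)%N by lia.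
have := polarize2 T a.+1 (K - a).+1.
rewrite (@sum_pick _ _ _ _ _ (Ordinal lta)) //; last first.
  by move=> j _; rewrite -val_eqE /= !eqSS; case: eqP => // ->; rewrite eqxx.
rewrite (@sum_pick _ _ _ _ _ (Ordinal ltKa)) //; last first.
  move=> j _; rewrite -val_eqE /= !eqSS; case: eqP => //= ->.
  by apply/eqP; lia.
rewrite /d /= -intrD -[RHS](mulr0z 1).
move=> /intr_inj; lia.
Qed.

(** The parts of [quad_eq] that are homogeneous of degrees 3 and 2 in the unknowns
    can be separated: the term of degree 1 involves only h_(K+3), and the two
    others are told apart by changing the sign of the unknowns. *)
Lemma cubic_quadratic_eq0 (c : nat -> F) :
  \sum_(k < K.+1) \sum_(j < K.+1 | (j <= k)%N)
     (dpair j k)%:~R * (c j.+1 * c (k - j).+1 * c (K - k).+1) = 0 /\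
  \sum_(k < K.+1) \sum_(j < K.+1 | (j <= k)%N)
     (dpair j k)%:~R * (c k.+2 * c (K - k).+1 + c j.+1 * c (K - j).+2) = 0.
Proof.
set T3 := (X in X = 0 /\ _); set T2 := (X in _ /\ X = 0).
have H (e : F) : e * e = 1 -> e * T3 - T2 = 0.
  move=> ee; pose h n := if n == K.+3 then 0 else e * c n.
  have /eqP := quad_eq h; rewrite -subr_eq0 /quad_part -sumrB => /eqP <-.
  rewrite /T3 /T2 mulr_sumr -sumrB; apply: eq_bigr => k _.
  rewrite mulr_sumr -!sumrB; apply: eq_bigr => j jk.
  rewrite !add0n /h eqxx.
  have := ltn_ord j; have := ltn_ord k => lk lj.
  rewrite !ifF; try by apply/eqP; lia.
  rewrite /dpair rmorphB /= -[e in LHS]mulr1 -ee.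
  by ring: ee.
have H1 := H 1 (mulr1 1); have := H (-1); rewrite mulrNN mulr1 => /(_ erefl) H2.
have T2_0 : T2 = 0.
  have /eqP : T2 *+ 2 = 0.
    have -> : T2 *+ 2 = - ((1 * T3 - T2) + (-1 * T3 - T2)) by ring.
    by rewrite H1 H2 addr0 oppr0.
  by rewrite mulrn_eq0 /= => /eqP.
by split => //; move: H1; rewrite T2_0 subr0 mul1r.
Qed.

Lemma double_bin2 n : ('C(n, 2))%:Z * 2 = n%:Z * (n%:Z - 1).
Proof. by elim: n => [|n IHn] //; rewrite binS bin1 PoszD mulrDl IHn; ring. Qed.

Let falling2 (x : int) := x * (x - 1).

(** The columns 0, ..., [k] contain ['C(psum f k.+1, 2)] pairs of north steps; the
    sum is the increment of this number from [k - 1] to [k]. *)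
Lemma double_column_sum (f : nat -> nat) k : (k <= K)%N ->
  (\sum_(j < K.+1 | (j <= k)%N) (pair_count f j k)%:Z) * 2
  = falling2 (psum f k.+1) - falling2 (psum f k).
Proof.
move=> kK; pose g j := (pair_count f j k)%:Z.
have -> : \sum_(j < K.+1 | (j <= k)%N) g j = \sum_(j < k.+1) g j.
  by rewrite (big_ord_widen K.+1).
rewrite /g /psum !big_ord_recr /= /pair_count eqxx.
rewrite (eq_bigr (fun j : 'I_k => (f j)%:Z * (f k)%:Z)) => [|j _]; last first.
  by rewrite ifF ?PoszM //; apply/eqP; have := ltn_ord j; lia.
by rewrite -mulr_suml mulrDl double_bin2 /falling2; ring.
Qed.

Lemma pair_count_mirror (f : nat -> nat) j k : (j <= K)%N -> (k <= K)%N ->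
  pair_count (mirror f) j k = pair_count f (K - k) (K - j).
Proof.
move=> jK kK; rewrite /pair_count /mirror.
have -> : (K - k == K - j)%N = (j == k) by apply/eqP/eqP; lia.
by case: eqP => [->|_]; rewrite // mulnC.
Qed.

(** A quadratic expression in the partial sums of [f] from the left and from the
    right; given the sum of these two partial sums, it determines the square of
    their difference. *)
Let energy (f : nat -> nat) m : int := falling2 (psum f m) + falling2 (psum (mirror f) m).

Lemma double_dpair_column k : (k <= K)%N ->
  (\sum_(j < K.+1 | (j <= k)%N) (dpair j k + dpair (K - k) (K - j))) * 2
  = (energy b k.+1 - energy b' k.+1) - (energy b k - energy b' k).
Proof.
move=> kK; rewrite big_split /= mulrDl.
rewrite (eq_bigr (fun j : 'I_K.+1 =>
  (pair_count (mirror b) j k)%:Z - (pair_count (mirror b') j k)%:Z)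
  (P := fun j => (j <= k)%N) (r := index_enum 'I_K.+1)
  (F1 := fun j => dpair (K - k) (K - j))) => [|j jk]; last first.
  by rewrite /dpair !pair_count_mirror //; have := ltn_ord j; lia.
rewrite /dpair !sumrB !mulrBl !double_column_sum // /energy; ring.
Qed.

(** The coefficient of h_(k+2) h_(K-k+1) in the quadratic part.  This monomial
    arises from column [k] and from column [K - k - 1], except that for [k = K]
    there is no second column. *)
Lemma energy_second_difference k : (k <= K)%N ->
  let D i := (energy b i.+1 - energy b' i.+1) - (energy b i - energy b' i) in
  D k + (if (k < K)%N then D (K - k.+1)%N else 0) = 0.
Proof.
move=> kK D.
pose d (k : 'I_K.+1) : int :=
  \sum_(j < K.+1 | (j <= k)%N) (dpair j k + dpair (K - k) (K - j)).
have T (c : nat -> F) :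
    \sum_(k < K.+1) (d k)%:~R * (c k.+2 * c (K - k).+1) = 0.
  have [_ T2] := cubic_quadratic_eq0 c; rewrite -{}[RHS]T2.
  under [RHS]eq_bigr => i _ do rewrite (eq_bigr _ (fun _ _ => mulrDr _ _ _))
    big_split /=.
  rewrite big_split /= [X in _ = _ + X](exchange_big_dep xpredT) //=.
  rewrite [X in _ = _ + X](reindex_inj rev_ord_inj) /= -big_split /=.
  apply: eq_bigr => i _; rewrite /d big_split /= rmorphD /= mulrDl.
  rewrite !rmorph_sum /= !mulr_suml; congr (_ + _).
  rewrite [RHS](reindex_inj rev_ord_inj) /=.
  have := ltn_ord i; rewrite ltnS => iK.
  apply: eq_big => [j|j ji]; rewrite !subSS; have := ltn_ord j; rewrite ltnS.
    by move=> jK; apply/idP/idP; lia.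
  by move=> jK; congr (_ * _); rewrite subKn // mulrC.
have ltk : (k < K.+1)%N by [].
have dE (i : 'I_K.+1) : d i * 2 = D i by rewrite /d double_dpair_column // -ltnS.
have := polarize2 T k.+2 (K - k).+1.
rewrite (@sum_pick _ _ _ _ _ (Ordinal ltk)) //; last first.
  by move=> j _; rewrite -val_eqE /= !eqSS; case: eqP => // ->; rewrite eqxx.
case: (ltnP k K) => [ltkK|leKk].
  have ltKk : (K - k.+1 < K.+1)%N by lia.
  rewrite (@sum_pick _ _ _ _ _ (Ordinal ltKk)) //; last first.
    move=> j _; rewrite -val_eqE /= !eqSS; apply/andP/eqP => [[/eqP ? _]|->].
      lia.
    by split; apply/eqP; lia.
  rewrite -intrD -[RHS](mulr0z 1) => /intr_inj.
  by move=> /(congr1 (fun x => x * 2)); rewrite mulrDl !dE mul0r.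
rewrite sum_pick0 => [|j _]; last by apply/negP => /andP[/eqP ? _]; lia.
rewrite !addr0 -[RHS](mulr0z 1) => /intr_inj.
by move=> /(congr1 (fun x => x * 2)); rewrite dE mul0r.
Qed.

(** The coefficient of h_(x+1) h_(y+1) h_(z+1) in the cubic part. *)
Lemma triple_relation x y z : (x + y + z = K)%N ->
  dpair x (K - z) + dpair x (K - y) + dpair y (K - z) + dpair y (K - x)
  + dpair z (K - y) + dpair z (K - x) = 0.
Proof.
move=> xyz.
have T (c : nat -> F) :
    \sum_(p : 'I_K.+1 * 'I_K.+1 | (p.2 <= p.1)%N) (dpair p.2 p.1)%:~R *
      (c p.2.+1 * c (p.1 - p.2).+1 * c (K - p.1).+1) = 0.
  by have [T3 _] := cubic_quadratic_eq0 c; rewrite -[RHS]T3 pair_big_dep.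
have pick u v t : (u + v + t = K)%N ->
    \sum_(p : 'I_K.+1 * 'I_K.+1 | (p.2 <= p.1)%N) (dpair p.2 p.1)%:~R *+
      [&& p.2.+1 == u.+1, (p.1 - p.2).+1 == v.+1 & (K - p.1).+1 == t.+1]
    = (dpair u (K - t))%:~R :> F.
  move=> uvt; have ltu : (u < K.+1)%N by lia.
  have ltt : (K - t < K.+1)%N by lia.
  rewrite (@sum_pick _ _ _ _ _ (Ordinal ltt, Ordinal ltu)) //=; first by lia.
  move=> [k j] /= jk; rewrite -pair_eqE /= -!val_eqE /= !eqSS.
  have := ltn_ord k; move: (k : nat) (j : nat) jk => {k j} k j jk kK.
  by apply/idP/idP; lia.
have := polarize3 T x.+1 y.+1 z.+1; rewrite /= !pick; try by lia.
by rewrite -!intrD -[RHS](mulr0z 1) => /intr_inj.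
Qed.

Lemma psum_mirror (f : nat -> nat) m : (m <= K.+1)%N ->
  psum (mirror f) m + psum f (K.+1 - m) = psum f K.+1.
Proof.
elim: m => [|m IHm] mK; first by rewrite /psum big_ord0 add0r subn0.
rewrite -IHm; last by lia.
rewrite /psum big_ord_recr /= (_ : K.+1 - m = (K - m).+1)%N; last by lia.
by rewrite big_ord_recr /= subSS /mirror; ring.
Qed.

Lemma psum_pair m : (m <= K.+1)%N ->
  psum b m + psum (mirror b) m = psum b' m + psum (mirror b') m.
Proof.
move=> mK; rewrite /psum -!big_split /=; apply: eq_bigr => i _.
by have := @column_pair_sum i; have := ltn_ord i; rewrite /mirror; lia.
Qed.

Lemma psum_total : psum b K.+1 = psum b' K.+1.
Proof.
have S0 f : psum f 0 = 0 by rewrite /psum big_ord0.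
have := psum_pair (leqnn K.+1); have := psum_mirror b (leqnn _).
by have := psum_mirror b' (leqnn _); rewrite subnn !S0 !addr0 => -> ->; lia.
Qed.

(** The difference [p] of the two energies is symmetric, by [psum_mirror], so
    [energy_second_difference] says that it is an affine function of the index.
    It vanishes at 0, hence at [K.+1], and the case [k = K] carries this over to
    [K] and by symmetry to 1. *)
Lemma energy_eq m : (m <= K.+1)%N -> energy b m = energy b' m.
Proof.
pose p m := energy b m - energy b' m.
have p0 : p 0%N = 0 by rewrite /p /energy /psum !big_ord0 subrr.
have pN i : (i <= K.+1)%N -> p (K.+1 - i)%N = p i.
  move=> iK; have lei : (K.+1 - i <= K.+1)%N by lia.
  have := psum_pair iK; have := psum_mirror b iK; have := psum_mirror b' iK.
  have := psum_mirror b lei; have := psum_mirror b' lei;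
  rewrite !subKn // -psum_total /p /energy.
  move: (K.+1 - i)%N => i'.
  move: (psum b i') (psum b' i') (psum (mirror b) i') (psum (mirror b') i').
  move: (psum b i) (psum b' i) (psum (mirror b) i) (psum (mirror b') i) (psum b K.+1).
  move=> d d' a a' t c c' s s' e1 e2 e3 e4 e5.
  have -> : c = t - a by lia.
  have -> : c' = t - a' by lia.
  have -> : s = t - d by lia.
  have -> : s' = t - d' by lia.
  have -> : d' = d + a - a' by lia.
  by rewrite /falling2; ring.
have pK : p K = 0.
  have /= := energy_second_difference (leqnn K); rewrite ltnn addr0.
  by rewrite -/(p K) -/(p K.+1) -[p K.+1]pN // subnn p0 sub0r => /eqP;
    rewrite oppr_eq0 => /eqP.
have p1 : p 1%N = 0 by rewrite -pN // subSS subn0.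
have step i : (i < K)%N -> p i.+2 = p i.+1 *+ 2 - p i.
  move=> iK; have := energy_second_difference (ltnW iK); rewrite /= iK.
  rewrite -!/(p _) (_ : (K - i.+1).+1 = (K.+1 - i.+1)%N); last by lia.
  rewrite pN; last by lia.
  rewrite (_ : K - i.+1 = (K.+1 - i.+2))%N ?pN; by lia.
have p00 i : (i <= K)%N -> p i = 0 /\ p i.+1 = 0.
  elim: i => [|i IHi] iK //; have [pi pSi] := IHi (ltnW iK).
  by rewrite step // pi pSi mul0rn subr0.
move=> mK; apply/eqP; rewrite -subr_eq0 -/(p m); apply/eqP.
by case: m mK => // m mK; have [] := p00 m.
Qed.

(** With [th f i = f i - f (K - i)], the sequences [phi] and [psi] are the sum and
    the difference of [th b] and [th b']; the previous lemmas provide the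
    hypotheses of [antisym_pair_rigid]. *)
Lemma counts_determined :
  (forall i, (i <= K)%N -> b i = b' i) \/
  (forall i, (i <= K)%N -> b i = b' (K - i)%N).
Proof.
pose th (f : nat -> nat) i : int := (f i)%:Z - (f (K - i)%N)%:Z.
pose phi i := th b i + th b' i; pose psi i := th b i - th b' i.
have thN f i : (i <= K)%N -> th f (K - i)%N = - th f i.
  by move=> iK; rewrite /th subKn // opprB.
have sum_th f m : \sum_(i < m) th f i = psum f m - psum (mirror f) m.
  by rewrite /th sumrB.
have sum_sqr m : (m <= K.+1)%N ->
    (\sum_(i < m) th b i) ^+ 2 = (\sum_(i < m) th b' i) ^+ 2.
  move=> mK; rewrite !sum_th.
  have := energy_eq mK; have := psum_pair mK; rewrite /energy.
  move: (psum b m) (psum b' m) (psum (mirror b) m) (psum (mirror b') m) => x x' y y' e1.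
  have -> : y' = x + y - x' by lia.
  rewrite /falling2 => /eqP; rewrite -subr_eq0 => /eqP e2; apply/eqP.
  rewrite -subr_eq0; apply/eqP; rewrite -[RHS](mulr0 2) -{}e2; ring.
(* For 0 < i < K this is triple_relation at i, K - i, 0.  At the ends that
   relation is empty, and the first partial sum gives the claim. *)
have th_sqr i : (i <= K)%N -> th b i ^+ 2 = th b' i ^+ 2.
  move=> iK; case: (posnP i) => [->|i_gt0].
    by have := sum_sqr 1%N isT; rewrite !big_ord1.
  case: (ltngtP i K) iK => // [ltiK|->] _; last first.
    have th0 f : th f 0%N = - th f K by rewrite -thN // subnn.
    by have := sum_sqr 1%N isT; rewrite !big_ord1 /= !th0 !sqrrN.
  have Ki : (i <= K)%N by lia.
  have := @triple_relation i (K - i) 0 _; rewrite addn0 subnKC // => /(_ erefl).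
  rewrite !subn0 !subKn // /dpair /pair_count !eqxx.
  have -> : (i == K) = false by lia.
  have -> : (K - i == K)%N = false by lia.
  have -> : (0 == i)%N = false by lia.
  have -> : (0 == K - i)%N = false by lia.
  have := double_bin2 (b i); have := double_bin2 (b' i).
  have := double_bin2 (b (K - i)); have := double_bin2 (b' (K - i)).
  have /(congr1 Posz) := column_pair_sum Ki.
  have /(congr1 Posz) := column_pair_sum (leq0n K).
  rewrite /th !subn0 !PoszM !PoszD.
  move: ('C(b i, 2))%:Z ('C(b' i, 2))%:Z => q1 q2.
  move: ('C(b (K - i), 2))%:Z ('C(b' (K - i), 2))%:Z => q3 q4.
  move: (b i : int) (b' i : int) (b (K - i)%N : int) (b' (K - i)%N : int).
  move: (b 0%N : int) (b' 0%N : int) (b K : int) (b' K : int).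
  move=> z z' k k' x x' y y' e1 e2 e3 e4 e5 e6 e7.
  have ez : k' = z + k - z' by lia.
  have ey : y' = x + y - x' by lia.
  subst k' y'.
  apply/eqP; rewrite -subr_eq0; apply/eqP; lra.
have th_tri x y z : (0 < x)%N -> (0 < y)%N -> (0 < z)%N -> (x + y + z = K)%N ->
    th b x * th b y + th b y * th b z + th b x * th b z
    = th b' x * th b' y + th b' y * th b' z + th b' x * th b' z.
  move=> x0 y0 z0 xyz; have := triple_relation xyz.
  have xK : (x <= K)%N by lia.
  have yK : (y <= K)%N by lia.
  have zK : (z <= K)%N by lia.
  have pcE f i j : (i + j < K)%N -> pair_count f i (K - j) = (f i * f (K - j))%N.
    by move=> ij; rewrite /pair_count ifF //; apply/eqP; lia.
  rewrite /dpair !pcE; try by lia.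
  have /(congr1 Posz) := column_pair_sum xK.
  have /(congr1 Posz) := column_pair_sum yK.
  have /(congr1 Posz) := column_pair_sum zK.
  rewrite /th !PoszM !PoszD.
  move: (b x : int) (b' x : int) (b (K - x)%N : int) (b' (K - x)%N : int).
  move: (b y : int) (b' y : int) (b (K - y)%N : int) (b' (K - y)%N : int).
  move: (b z : int) (b' z : int) (b (K - z)%N : int) (b' (K - z)%N : int).
  move=> z1 z1' z2 z2' y1 y1' y2 y2' x1 x1' x2 x2' e1 e2 e3 e4.
  have ? : z2' = z1 + z2 - z1' by lia.
  have ? : y2' = y1 + y2 - y1' by lia.
  have ? : x2' = x1 + x2 - x1' by lia.
  subst x2' y2' z2'; apply/eqP; rewrite -subr_eq0; apply/eqP; lra.
have phiN i : (i <= K)%N -> phi (K - i)%N = - phi i.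
  by move=> iK; have := thN b i iK; have := thN b' i iK; rewrite /phi; lia.
have psiN i : (i <= K)%N -> psi (K - i)%N = - psi i.
  by move=> iK; have := thN b i iK; have := thN b' i iK; rewrite /psi; lia.
have disj i : (i <= K)%N -> phi i * psi i = 0.
  move=> iK; transitivity (th b i ^+ 2 - th b' i ^+ 2); last by rewrite th_sqr // subrr.
  by rewrite /phi /psi; ring.
have [phi0|psi0] : (forall i, (i <= K)%N -> phi i = 0) \/
                   (forall i, (i <= K)%N -> psi i = 0).
- apply: antisym_pair_rigid => //.
  + move=> m mK; have uv := sum_sqr m mK.
    have -> : \sum_(i < m) phi i = \sum_(i < m) th b i + \sum_(i < m) th b' i.
      by rewrite -big_split.
    have -> : \sum_(i < m) psi i = \sum_(i < m) th b i - \sum_(i < m) th b' i.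
      by rewrite -sumrB.
    move: uv; move: (\sum_(i < m) th b i) (\sum_(i < m) th b' i) => u v uv.
    by transitivity (u ^+ 2 - v ^+ 2); [ring | rewrite uv subrr].
  + move=> x y xyK px py.
    case: (posnP x) => [->|x0]; first by right.
    case: (posnP y) => [->|y0]; first by left; rewrite addn0.
    have xK : (x <= K)%N by lia.
    have yK : (y <= K)%N by lia.
    have psix : psi x = 0.
      by have /eqP := disj x xK; rewrite mulf_eq0 (negPf px) => /eqP.
    have phiy : phi y = 0.
      by have /eqP := disj y yK; rewrite mulf_eq0 (negPf py) orbF => /eqP.
    case: (ltngtP (x + y) K) xyK => // [ltK|eqK] _; last first.
      move: py; rewrite (_ : y = K - x)%N ?psiN ?psix ?oppr0 ?eqxx //; lia.
    have z0 : (0 < K - (x + y))%N by lia.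
    have := th_tri x y (K - (x + y))%N x0 y0 z0.
    rewrite subnKC; last exact: ltnW.
    move=> /(_ erefl); rewrite !(thN _ _ (ltnW ltK)); have := disj (x + y)%N (ltnW ltK).
    move: px py psix phiy; rewrite /phi /psi.
    move: (th b x) (th b' x) (th b y) (th b' y).
    move: (th b (x + y)%N) (th b' (x + y)%N).
    move=> t t' p p' q q' px py psix phiy /eqP dis rel.
    have ? : p' = p by lia.
    have ? : q' = - q by lia.
    subst p' q'.
    have {}px : p != 0 by lia.
    have {}py : q != 0 by lia.
    move: dis; rewrite mulf_eq0 => /orP[] /eqP dis; [right|left].
      have ? : t' = - t by lia.
      subst t'; have /eqP : p * (q - t) = 0 by lra.
      by rewrite mulf_eq0 (negPf px) => /eqP; lia.
    have ? : t' = t by lia.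
    subst t'; have /eqP : q * (p - t) = 0 by lra.
    by rewrite mulf_eq0 (negPf py) => /eqP; lia.
- right=> i iK; have := phi0 i iK; have := column_pair_sum iK.
  by rewrite /phi /th; lia.
- left=> i iK; have := psi0 i iK; have := column_pair_sum iK.
  by rewrite /psi /th; lia.
Qed.

End Coefficients.

Section WordsDetermined.

Variable F : numClosedFieldType.

Let agree w w' := forall n (y : nat -> F),
  fill (fun i => y i *: 'X) n w = fill (fun i => y i *: 'X) n w'.

Let fill_prescribed (c : nat -> F) D : exists n (y : nat -> F) (h : nat -> F),
  (forall k, fill (fun i => y i *: 'X) n (nseq k false) = h k.+1 *: 'X^(k.+1))
  /\ (forall k, (0 < k <= D)%N -> h k = c k).
Proof.
have [n [y yc]] := complete_prescribed c D.
exists n, y, (fun k => fill y n (nseq k.-1 false)).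
by split=> [k|[|k] // kD]; [exact: fill_east_scale | exact: yc].
Qed.

Let agree_east_le w w' : agree w w' -> (east w' <= east w)%N.
Proof.
move=> ww'; rewrite leqNgt; apply/negP => lt.
have [n [y [h [yh hc]]]] := fill_prescribed (fun=> 1) (east w).+1.
have := fill_coef0 yh 0 w; rewrite add0n hc ?ltnSn //= ww'.
have -> := fill_coef_low yh (i := 0) lt.
by move/esym/eqP; rewrite oner_eq0.
Qed.

(** Scaling the variables by ['X] separates the homogeneous parts of [fill]. *)
Lemma words_determined w w' : agree w w' -> w = w' \/ w = rev w'.
Proof.
move=> ww'; have eqE : east w = east w'.
  apply/eqP; rewrite eqn_leq !agree_east_le // => n y; exact/esym/ww'.
have lin (c : nat -> F) :
    lin_part c 0 (east w) (north w) = lin_part c 0 (east w) (north w').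
  have [n [y [h [yh hc]]]] := fill_prescribed c (east w).+3.
  have trunc v : lin_part c 0 (east w) v = lin_part h 0 (east w) v.
    apply: eq_bigr => j _; have := ltn_ord j => ltj.
    by rewrite !hc //; lia.
  by rewrite !trunc {2}eqE -!(fill_coef1 yh 0) /= ww' eqE.
have quad (c : nat -> F) :
    quad_part c 0 (east w) (north w) = quad_part c 0 (east w) (north w').
  have [n [y [h [yh hc]]]] := fill_prescribed c (east w).+3.
  have trunc v : quad_part c 0 (east w) v = quad_part h 0 (east w) v.
    apply: eq_bigr => k _; apply: eq_bigr => j jk.
    have := ltn_ord k; have := ltn_ord j => ltj ltk.
    by rewrite !hc //; lia.
  by rewrite !trunc {2}eqE -!(fill_coef2 yh 0) /= ww' eqE.
have [eqN|eqN] := counts_determined lin quad.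
  by left; apply: north_inj.
right; apply: north_inj => [|j jw]; first by rewrite count_rev.
by rewrite north_rev -eqE // eqN.
Qed.

End WordsDetermined.

(** * Ribbons as paths of boxes *)

Definition step_box (u : box) (north_step : bool) : box :=
  if north_step then (u.1 - 1, u.2) else (u.1, u.2 + 1).

Fixpoint ribbon_path (v : box) (w : seq bool) : seq box :=
  v :: (if w is d :: w' then ribbon_path (step_box v d) w' else [::]).

(** It increases by one at each step of a ribbon, so it orders the boxes of a
    ribbon and shows that the set of boxes determines the path. *)
Definition diagonal (u : box) : int := u.2 - u.1.

Lemma size_ribbon_path v w : size (ribbon_path v w) = (size w).+1.
Proof. by elim: w v => //= d w IHw v; rewrite IHw. Qed.

Lemma mem_head_path v w : v \in ribbon_path v w.
Proof. by case: w => *; rewrite /= mem_head. Qed.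

Lemma ribbon_path_dir v w u : u \in ribbon_path v w ->
  (u.1 <= v.1) && (v.2 <= u.2).
Proof.
elim: w v => [|d w IHw] v /=; first by rewrite inE => /eqP ->; rewrite !lexx.
rewrite inE => /predU1P[->|/IHw]; first by rewrite !lexx.
by case: d; rewrite /step_box /=; lia.
Qed.

Definition lt_diagonal (u v : box) := diagonal u < diagonal v.

Lemma ribbon_path_sorted v w : sorted lt_diagonal (ribbon_path v w).
Proof.
rewrite sorted_pairwise; last by move=> ? ? ?; apply: lt_trans.
elim: w v => [|d w IHw] v //=; rewrite IHw andbT; apply/allP => u /ribbon_path_dir.
by rewrite /lt_diagonal /diagonal; case: d; rewrite /step_box /=; lia.
Qed.

Lemma ribbon_path_uniq v w : uniq (ribbon_path v w).
Proof.
apply: (sorted_uniq (leT := lt_diagonal)) (ribbon_path_sorted v w).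
  by move=> ? ? ?; apply: lt_trans.
by move=> ?; apply: ltxx.
Qed.

Lemma ribbon_path_inj v v' w w' : ribbon_path v w =i ribbon_path v' w' -> w = w'.
Proof.
move=> eqm; have: ribbon_path v w = ribbon_path v' w'.
  apply: (irr_sorted_eq (leT := lt_diagonal)) => //; try exact: ribbon_path_sorted.
    by move=> ? ? ?; apply: lt_trans.
  by move=> ?; apply: ltxx.
elim: w v v' w' {eqm} => [|d w IHw] v v' [|d' w'] //=.
- by case: w'.
- by case: w {IHw}.
case=> <- eq; have /= := congr1 (head v) eq.
have hd u t : head v (ribbon_path u t) = u by case: t.
rewrite !hd => eqs; congr (_ :: _); last by apply: IHw eq.
by move/eqP: eqs; rewrite -pair_eqE /=; case: (d); case: (d') => //= /andP[]; lia.
Qed.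

Lemma ribbon_path_translate t v w :
  ribbon_path (v + t) w = [seq u + t | u <- ribbon_path v w].
Proof.
elim: w v => [|d w IHw] v //=; rewrite -IHw; congr (_ :: ribbon_path _ _).
by case: v t d {IHw} => [a b] [e f] []; congr pair; rewrite /=; lia.
Qed.

Definition last_box := foldl step_box.

Lemma ribbon_path_rcons v w d : ribbon_path v (rcons w d)
  = rcons (ribbon_path v w) (step_box (last_box v w) d).
Proof. by elim: w v => //= e w IHw v; rewrite IHw. Qed.

Lemma ribbon_path_rot v w : rev [seq - u | u <- ribbon_path v w]
  = ribbon_path (- last_box v w) (rev w).
Proof.
have stepN u d : step_box (- step_box u d) d = - u.
  by case: u d => [a b] []; congr pair; rewrite /=; lia.
have lastN u t : last_box (- last_box u t) (rev t) = - u.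
  elim: t u => //= d t IHt u.
  by rewrite rev_cons -cats1 /last_box foldl_cat -/last_box IHt /= stepN.
elim: w v => //= d w IHw v.
by rewrite rev_cons IHw rev_cons ribbon_path_rcons lastN stepN.
Qed.

Lemma ribbon_path_succ v w u : u \in ribbon_path v w ->
  u = last_box v w \/ exists d, step_box u d \in ribbon_path v w.
Proof.
elim: w v => [|d w IHw] v /=; first by rewrite inE => /eqP; left.
rewrite inE => /predU1P[->|/IHw[|[e uw]]]; [|by left|].
  by right; exists d; rewrite inE mem_head_path orbT.
by right; exists e; rewrite inE uw orbT.
Qed.

Lemma ribbon_path_pred v w u : u \in ribbon_path v w ->
  u = v \/ exists d, exists2 u', u' \in ribbon_path v w & u = step_box u' d.
Proof.
elim: w v => [|d w IHw] v /=; first by rewrite inE => /eqP; left.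
rewrite inE => /predU1P[->|/IHw[->|[e [u' u'w ->]]]]; [by left| |]; right.
  by exists d, v; rewrite ?mem_head.
by exists e, u'; rewrite // inE u'w orbT.
Qed.

Lemma partition_nth_le la i j : is_partition la -> (i <= j)%N ->
  (nth 0 la j <= nth 0 la i)%N.
Proof.
case/andP => la_sorted _ ij; have [jla|laj] := ltnP j (size la); last first.
  by rewrite nth_default.
have geq_trans : transitive geq by move=> a b c; rewrite /geq /=; lia.
have geq_refl : reflexive geq by move=> a; apply: leqnn.
have := sorted_leq_nth geq_trans geq_refl 0%N la_sorted.
by move=> /(_ i j); apply; rewrite ?inE //; lia.
Qed.

Lemma diagram_nat s u : u \in diagram s -> exists i j : nat, u = (i%:Z, j%:Z).
Proof.
rewrite in_fsetD => /andP[_ /imfset2P[i _ [j _ ->]]].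
by exists i, j.
Qed.

(** A skew diagram is the difference of two order ideals of the product order,
    hence it contains the whole interval between two of its boxes. *)
Lemma diagram_convex s (u x v : box) : u \in diagram s -> v \in diagram s ->
  u.1 <= x.1 <= v.1 -> u.2 <= x.2 <= v.2 -> x \in diagram s.
Proof.
case: x => x1 x2 uD vD.
have [i [j uE]] := diagram_nat uD; have [k [l vE]] := diagram_nat vD.
subst u v; rewrite /= => /andP[ix xk] /andP[jx xl].
have [a aE] : exists a : nat, x1 = a%:Z by exists `|x1|%N; lia.
have [b bE] : exists b : nat, x2 = b%:Z by exists `|x2|%N; lia.
subst x1 x2; move: uD vD; rewrite !in_diagram => /andP[ij _] /andP[_ lk].
have := @partition_nth_le _ i a (inner_partition s).
have := @partition_nth_le _ a k (outer_partition s).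
lia.
Qed.

Lemma share_edgeP (u x : box) : share_edge u x ->
  [\/ x = step_box u false, x = step_box u true,
      u = step_box x false | u = step_box x true].
Proof.
case: u x => [a b] [c d]; rewrite /share_edge /step_box /= => /eqP H.
have [[-> ->]|[[-> ->]|[[-> ->]|[-> ->]]]] :
   (c = a /\ d = b + 1) \/ (c = a - 1 /\ d = b) \/ (a = c /\ b = d + 1)
     \/ (a = c - 1 /\ b = d) by lia.
- by constructor 1.
- by constructor 2.
- by constructor 3.
- by constructor 4.
Qed.

(** A maximal path that starts at a box of minimal diagonal covers the diagram.
    Indeed, by connectedness it suffices that a box adjacent to the path lies on
    it; otherwise a box of the path would have two successors, or two
    predecessors, in the diagram, and the interval between these would complete
    a 2x2 square. *)
Lemma ribbon_is_path s : ribbon s -> diagram s != fset0 ->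
  exists v w, diagram s =i ribbon_path v w.
Proof.
move=> [conn no2] /fset0Pn[u0 u0D]; set D := diagram s in conn no2 u0D *.
have convex (u x v : box) : u \in D -> v \in D ->
  u.1 <= x.1 <= v.1 -> u.2 <= x.2 <= v.2 -> x \in D by apply: diagram_convex.
have [v vD vmin] : exists2 v, v \in D & forall u, u \in D -> diagonal v <= diagonal u.
  case: (@Order.TotalTheory.arg_minP _ _ D [` u0D] xpredT (fun u => diagonal (val u)) isT).
  move=> v _ vmin; exists (val v); first exact: fsvalP.
  by move=> u uD; apply: (vmin [` uD]).
(* A path in D cannot have more boxes than D, so some path is stuck. *)
have extend k : exists2 w, {subset ribbon_path v w <= D} &
    size w = k \/ forall d, step_box (last_box v w) d \notin D.
  elim: k => [|k [w wD [sw|stuck]]].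
  - by exists [::]; [move=> u; rewrite inE => /eqP -> | left].
  - have [dD|stuck] := pselect (exists d, step_box (last_box v w) d \in D).
      case: dD => d dD; exists (rcons w d); last by left; rewrite size_rcons sw.
      by move=> u; rewrite ribbon_path_rcons mem_rcons inE => /predU1P[->|/wD].
    by exists w => //; right=> d; apply/negP => dD; case: stuck; exists d.
  - by exists w => //; right.
have [w wD [sw|stuck]] := extend #|` D|.
  have := uniq_leq_size (ribbon_path_uniq v w) wD.
  by rewrite size_ribbon_path sw ltnn.
exists v, w.
have closed (u x : box) : u \in ribbon_path v w -> x \in D -> share_edge u x ->
    x \in ribbon_path v w.
  move=> up xD /share_edgeP H.
  have uD := wD _ up.
  have [[d xE]|[d uE]] : (exists d, x = step_box u d) \/ (exists d, u = step_box x d).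
    by case: H => ->; [left; exists false|left; exists true|
      right; exists false|right; exists true].
  - have [uE|[e ep]] := ribbon_path_succ up.
      by have := stuck d; rewrite -uE -xE xD.
    have eD := wD _ ep; have [de|de] := eqVneq d e; first by rewrite xE de.
    exfalso; pose a := step_box u true; pose b := step_box u false.
    have [aD bD] : a \in D /\ b \in D.
      by rewrite /a /b; case: d e xE ep eD de => [] [] // xE ep eD _; rewrite -?xE.
    have uE : (u.1 - 1 + 1, u.2) = u by rewrite subrK -surjective_pairing.
    apply: no2; exists (u.1 - 1), u.2; split=> //; rewrite ?uE ?subrK //.
    by apply: (convex a _ b) => //; rewrite /a /b /step_box /=; lia.
  - have [uv|[e [y yp yE]]] := ribbon_path_pred up.
      have := vmin x xD; rewrite -uv uE /diagonal.
      by case: (d); rewrite /step_box /=; lia.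
    have [de|de] := eqVneq d e.
      suff -> : x = y by [].
      move: yE; rewrite uE -de; case: x y {uE xD yp H} => [x1 x2] [y1 y2].
      by case: (d) => -[? ?]; congr pair; lia.
    exfalso; have yD := wD _ yp.
    have [x' [y' [x'D y'D ux uy]]] : exists x' y', [/\ x' \in D, y' \in D,
        u = step_box x' true & u = step_box y' false].
      by case: d e uE yE de => [] [] // uE yE _; [exists x, y|exists y, x].
    have x'E : x' = (y'.1 + 1, y'.2 + 1).
      case: x' y' ux uy {x'D y'D} => [a b] [c f] ->; rewrite /step_box /= => -[? ?].
      by congr pair; lia.
    apply: no2; exists y'.1, y'.2; split; rewrite -?x'E -?surjective_pairing //.
      by rewrite /step_box /= in uy; rewrite -uy.
    by apply: (convex y' _ x') => //; rewrite x'E /=; lia.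
have all_reached (x y : D) : val x \in ribbon_path v w ->
    connect (fun x y : D => share_edge (val x) (val y)) x y ->
    val y \in ribbon_path v w.
  move=> xp /connectP[q qpath ->]; elim: q x xp qpath => [|z q IHq] x xp //=.
  by case/andP => xz; apply: IHq; apply: closed xp (fsvalP z) xz.
move=> u; apply/idP/idP => [uD|]; last exact: wD.
exact: (all_reached [` vD] [` uD] (mem_head_path v w) (conn _ _)).
Qed.

(** * Reverse plane partitions of a ribbon as sequences of values *)

Definition rpp_on (D : pred box) (P : box -> nat) :=
  (forall u v, D u -> D v -> u.1 = v.1 -> u.2 <= v.2 -> (P u <= P v)%N) /\
  (forall u v, D u -> D v -> u.2 = v.2 -> u.1 <= v.1 -> (P u <= P v)%N).

(** Along a path the rows and the columns are contiguous, so comparing consecutive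
    boxes suffices. *)
Lemma rpp_on_path v d w P :
  rpp_on (mem (ribbon_path v (d :: w))) P <->
  rpp_on (mem (ribbon_path (step_box v d) w)) P /\
  (if d then P (step_box v d) <= P v else P v <= P (step_box v d))%N.
Proof.
set v' := step_box v d; set p' := ribbon_path v' w.
have v'p : v' \in p' by apply: mem_head_path.
have sub u : u \in p' -> u \in ribbon_path v (d :: w).
  by move=> up; rewrite inE up orbT.
split=> [[Hr Hc]|[[Hr Hc] Hv]].
  split; first by split=> u u' up u'p; [apply: Hr | apply: Hc]; apply: sub.
  case: d @v' @p' v'p sub Hr Hc => v' p' v'p sub Hr Hc.
    by apply: Hc; [apply: sub v'p|apply: mem_head|by []|]; rewrite /v' /step_box /=; lia.
  by apply: Hr; [apply: mem_head|apply: sub v'p|by []|]; rewrite /v' /step_box /=; lia.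
have dir u : u \in p' -> (u.1 <= v'.1) && (v'.2 <= u.2) by apply: ribbon_path_dir.
split=> u u' /=; rewrite !inE => /predU1P[->|up] /predU1P[->|u'p] //;
  try by [apply: Hr | apply: Hc].
- move=> eq1 le2; have := dir _ u'p; move: Hv; rewrite /v'.
  case: d @v' @p' {v'p sub} Hr Hc u'p dir => v' p' Hr Hc u'p dir /= Hv.
    by rewrite -eq1; lia.
  move=> H; apply: leq_trans Hv _; apply: Hr => //; first exact: mem_head_path.
  by case/andP: H.
- move=> eq1 le2; have := dir _ up; rewrite /v' /step_box.
  by case: (d) => /=; lia.
- move=> eq1 le2; have := dir _ u'p; rewrite /v' /step_box.
  by case: (d) => /=; lia.
- move=> eq1 le2; have := dir _ up; move: Hv; rewrite /v'.
  case: d @v' @p' {v'p sub} Hr Hc up dir => v' p' Hr Hc up dir /= Hv.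
    move=> H; apply: leq_trans _ Hv; apply: Hc => //; first exact: mem_head_path.
    by case/andP: H.
  by rewrite eq1; lia.
Qed.

(** The reverse plane partitions of a ribbon with steps [w] and entries at most
    [n], read along its path; see [rpp_on_fillings]. *)
Fixpoint fillings (n : nat) (w : seq bool) (a : nat) : seq (seq nat) :=
  if w is d :: w' then
    let next := if d then index_iota 1 a.+1 else index_iota a n.+1 in
    [seq a :: t | t <- flatten [seq fillings n w' b | b <- next]]
  else [:: [:: a]].

(** Equal values on both sides of a north step lie in one column, where they are
    counted once. *)
Fixpoint content (w : seq bool) (t : seq nat) : {cmonom nat} :=
  match w, t with
  | d :: w', a :: t' =>
      if d && (a == head 0%N t') then content w' t'
      else mulcm (ucm a) (content w' t')
  | _, a :: _ => ucm a
  | _, [::] => onecm _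
  end.

Definition all_fillings n w : seq (seq nat) :=
  flatten [seq fillings n w a | a <- index_iota 1 n.+1].

Definition contents n w : seq {cmonom nat} :=
  [seq content w t | t <- all_fillings n w].

Lemma fillings_head n w a t : t \in fillings n w a -> exists t', t = a :: t'.
Proof.
case: w => [|d w] /=; first by rewrite inE => /eqP ->; exists [::].
by case/mapP => t' _ ->; exists t'.
Qed.

Lemma mem_fillings n d w a b t :
  (a :: b :: t \in fillings n (d :: w) a) =
  (if d then 0 < b <= a else a <= b <= n)%N && (b :: t \in fillings n w b).
Proof.
rewrite /= mem_map => [|s s' []//]; apply/flatten_mapP/andP.
  case=> c cI tc; have [t' [bc _]] := fillings_head tc; subst c.
  by split=> //; move: cI; case: d; rewrite mem_index_iota ltnS.
by case=> bI tb; exists b => //; move: bI; case: d; rewrite mem_index_iota ltnS.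
Qed.

Lemma flatten_fillings_uniq n w s : (forall a, uniq (fillings n w a)) ->
  uniq s -> uniq (flatten [seq fillings n w a | a <- s]).
Proof.
move=> uF; elim: s => //= b s IHs /andP[bs us].
rewrite cat_uniq uF IHs // andbT.
apply/hasPn => t /flatten_mapP[c cs tc]; apply/negP => tb.
have [t1 E1] := fillings_head tc; have [t2 E2] := fillings_head tb.
by move: E2; rewrite E1 => -[cb _]; rewrite -cb cs in bs.
Qed.

Lemma fillings_uniq n w a : uniq (fillings n w a).
Proof.
elim: w a => [|d w IHw] a //=; rewrite map_inj_uniq => [|s s' []//].
by apply: flatten_fillings_uniq => //; case: d; apply: iota_uniq.
Qed.

Lemma all_fillings_uniq n w : uniq (all_fillings n w).
Proof.
by apply: flatten_fillings_uniq => [a|]; [apply: fillings_uniq|apply: iota_uniq].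
Qed.

Lemma all_fillingsP n w t : t \in all_fillings n w ->
  exists2 a, (0 < a <= n)%N & t \in fillings n w a.
Proof.
by case/flatten_mapP => a; rewrite mem_index_iota ltnS => aI tI; exists a.
Qed.

(** The evaluation [ev] is left abstract because two of them are needed: the value
    of a monomial at a point, and the monomial itself in a monoid algebra. *)
Lemma fill_from_contents (R : comNzRingType) (x : nat -> R)
    (ev : {cmonom nat} -> R) n w a :
  ev (onecm _) = 1 ->
  (forall i m, (i <= n)%N -> ev (mulcm (ucm i) m) = x i * ev m) -> (0 < a <= n)%N ->
  \sum_(t <- fillings n w a) ev (content w t) = fill_from x n w a.
Proof.
move=> ev1 evM; elim: w a => [|d w IHw] a /andP[a0 aN].
  by rewrite big_seq1 /= -[ucm a]mulcm0 evM // ev1 mulr1.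
have step b : (0 < b <= n)%N -> \sum_(t <- fillings n w b) ev (content (d :: w) (a :: t))
    = if d && (a == b) then fill_from x n w b else x a * fill_from x n w b.
  move=> bn; rewrite -IHw //.
  rewrite (eq_big_seq (fun t => if d && (a == b) then ev (content w t)
    else x a * ev (content w t))) => [|t tb]; last first.
    by have [t' ->] := fillings_head tb; rewrite /=; case: ifP => //; rewrite evM.
  by case: ifP => // _; rewrite mulr_sumr.
rewrite [fillings _ _ _]/= big_map big_flatten big_map /=.
case: d step => step.
  rewrite big_nat_recr //= addrC step ?a0 // eqxx; congr (_ + _).
  rewrite mulr_sumr !big_nat; apply: eq_bigr => b /andP[b0 ba].
  by rewrite step ?(gtn_eqF ba) //; lia.
rewrite mulr_sumr !big_nat; apply: eq_bigr => b /andP[ab bn].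
by rewrite step // (leq_trans a0 ab).
Qed.

Lemma fill_contents (R : comNzRingType) (x : nat -> R)
    (ev : {cmonom nat} -> R) n w :
  ev (onecm _) = 1 ->
  (forall i m, (i <= n)%N -> ev (mulcm (ucm i) m) = x i * ev m) ->
  \sum_(m <- contents n w) ev m = fill x n w.
Proof.
move=> ev1 evM; rewrite /contents big_map big_flatten big_map /fill big_nat [RHS]big_nat.
by apply: eq_bigr => a aI; apply: fill_from_contents.
Qed.

Lemma fill_of_contents (R : comNzRingType) (x : nat -> R) n w w' :
  perm_eq (contents n w) (contents n w') -> fill x n w = fill x n w'.
Proof.
move=> eqc; pose ev (m : {cmonom nat}) := \prod_(i < n.+1) x i ^+ m i.
have ev1 : ev (onecm _) = 1 by rewrite /ev big1 // => i _; rewrite onecmE.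
have evM i m : (i <= n)%N -> ev (mulcm (ucm i) m) = x i * ev m.
  move=> iN; rewrite /ev; under eq_bigr => j _ do rewrite mulcmE exprD.
  rewrite big_split /=; congr (_ * _).
  rewrite (bigD1 (Ordinal (iN : (i < n.+1)%N))) //= ucmE eqxx expr1 big1 ?mulr1 //.
  move=> j /eqP ji; rewrite ucmE; case: eqP => [E|_ //].
  by case: ji; apply: val_inj.
by rewrite -!(fill_contents _ ev1 evM) (perm_big _ eqc).
Qed.

Lemma count_contents n w m :
  (count_mem m (contents n w))%:R
  = (fill (fun i => << ucm i >> : {malg int[{cmonom nat}]}) n w)@_m.
Proof.
rewrite -(fill_contents w (ev := fun m => << m >>)) //; last first.
  by move=> i m' _; rewrite malgM_def fgmulUU mulr1.
rewrite raddf_sum /= -sum1_count natr_sum big_mkcond /=.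
by apply: eq_bigr => m' _; rewrite mcoeffU; case: eqP.
Qed.

Lemma size_fillings n w a t : t \in fillings n w a -> size t = (size w).+1.
Proof.
elim: w a t => [|d w IHw] a t /=; first by rewrite inE => /eqP ->.
by case/mapP => s /flatten_mapP[b _ sb] -> /=; rewrite (IHw b).
Qed.

Lemma fillings_range n w a t b : (0 < a <= n)%N -> t \in fillings n w a ->
  b \in t -> (0 < b <= n)%N.
Proof.
elim: w a t => [|d w IHw] a t aN /=.
  by rewrite inE => /eqP ->; rewrite inE => /eqP ->.
case/mapP => s /flatten_mapP[c cI sc] ->; rewrite inE => /predU1P[->//|].
by apply: (IHw c) => //; move: cI; case: d; rewrite mem_index_iota; lia.
Qed.

Lemma rpp_on_fillings n v w (P : box -> nat) :
  (forall u, u \in ribbon_path v w -> (0 < P u <= n)%N) ->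
  rpp_on (mem (ribbon_path v w)) P <->
  map P (ribbon_path v w) \in fillings n w (P v).
Proof.
elim: w v => [|d w IHw] v rangeP.
  rewrite /= inE eqxx; split=> // _; split=> u u'; rewrite !inE;
  by move=> /eqP -> /eqP ->.
rewrite rpp_on_path IHw; last by move=> u uw; apply: rangeP; rewrite /= inE uw orbT.
have -> : map P (ribbon_path v (d :: w)) =
    P v :: map P (ribbon_path (step_box v d) w) by [].
have [t E] : exists t, map P (ribbon_path (step_box v d) w) = P (step_box v d) :: t.
  by case: (w) => [|d' w'] /=; eexists.
rewrite E mem_fillings -E.
have /andP[P0 PN] : (0 < P (step_box v d) <= n)%N.
  by apply: rangeP; rewrite /= inE mem_head_path orbT.
by case: (d) P0 PN => P0 PN; rewrite ?P0 ?PN ?andbT ?andTb;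
  split=> [[? ?]|/andP[? ?]] //; apply/andP.
Qed.

(** Along a column the values decrease weakly, so the boxes of a column with a
    given value are consecutive. *)
Lemma content_columns v w (P : box -> nat) i :
  rpp_on (mem (ribbon_path v w)) P ->
  content w (map P (ribbon_path v w)) i
  = size (undup [seq u.2 | u <- ribbon_path v w & P u == i]).
Proof.
elim: w v => [|d w IHw] v.
  by move=> _; rewrite /= ucmE; case: eqP.
rewrite rpp_on_path => -[rppP Pv]; have IH := IHw _ rppP.
have [t E] : exists t, map P (ribbon_path (step_box v d) w) = P (step_box v d) :: t.
  by case: (w) => [|d' w'] /=; eexists.
set v' := step_box v d in rppP Pv IH E *.
have -> : ribbon_path v (d :: w) = v :: ribbon_path v' w by [].
set L := [seq u.2 | u <- ribbon_path v' w & P u == i] in IH *.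
have head_v' : head 0%N (map P (ribbon_path v' w)) = P v' by rewrite E.
have -> : content (d :: w) (map P (v :: ribbon_path v' w)) i
    = (~~ (d && (P v == P v')) && (P v == i) + content w (map P (ribbon_path v' w)) i)%N.
  by rewrite [map _ _]/= [content _ _]/= head_v'; case: ifP => _; rewrite ?mulcmE ?ucmE.
rewrite IH /=; case: (eqVneq (P v) i) => [Pvi|_]; last by rewrite andbF.
rewrite andbT /=; suff -> : v.2 \in L = d && (P v == P v') by case: ifP.
apply/mapP/andP => [[u]|[d_true /eqP Pvv']].
  rewrite mem_filter => /andP[/eqP Pui up] eq2.
  have dir := ribbon_path_dir up; have [dT|dF] := boolP d; last first.
    by move: dir; rewrite /v' /step_box (negPf dF) /=; lia.
  rewrite dT in Pv; split=> //; rewrite eqn_leq Pv andbT Pvi -Pui.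
  have [_ Hc] := rppP; apply: Hc => //; first exact: mem_head_path.
    by rewrite -eq2 /v' /step_box dT.
  by case/andP: dir.
exists v'; last by rewrite /v' d_true.
by rewrite mem_filter -Pvv' Pvi eqxx mem_head_path.
Qed.

Lemma content_support w t i : content w t i != 0%N -> i \in t.
Proof.
elim: w t => [|d w IHw] [|a t] //=; rewrite ?onecmE //.
  by rewrite ucmE inE eqb0 negbK eq_sym => ->.
rewrite inE; case: ifP => _; first by move=> /IHw ->; rewrite orbT.
by rewrite mulcmE ucmE addn_eq0 negb_and eqb0 negbK eq_sym => /orP[->|/IHw->];
  rewrite ?orbT.
Qed.

Lemma contents_support n w (m : {cmonom nat}) i :
  m \in contents n w -> m i != 0%N -> (i <= n)%N.
Proof.
case/mapP => t /all_fillingsP[a aI tI] -> /content_support it.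
by have /andP[] := fillings_range aI tI it.
Qed.

Section DualCoefficient.

Variables (D : {fset box}) (v : box) (w : seq bool).
Hypothesis D_path : D =i ribbon_path v w.

Let p := ribbon_path v w.
Let ext (P : {ffun D -> nat}) (u : box) : nat := oapp P 0%N (insub u).
Let mk (t : seq nat) : {ffun D -> nat} := [ffun u => nth 0%N t (index (val u) p)].

Let val_path (u : D) : val u \in p. Proof. by rewrite -D_path; apply: fsvalP. Qed.

Let ext_val P (u : D) : ext P (val u) = P u.
Proof. by rewrite /ext valK. Qed.

Let ext_pathP (u : box) : u \in p -> exists x : D, u = val x.
Proof. by rewrite -D_path => uD; exists [` uD]. Qed.

Lemma rpp_on_ext P : reverse_plane_partition P <->
  rpp_on (mem p) (ext P) /\ (forall u, u \in p -> (0 < ext P u)%N).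
Proof.
split=> [[P0 Pr Pc]|[[Pr Pc] P0]].
  split; last by move=> u /ext_pathP[x ->]; rewrite ext_val.
  by split=> u u' /ext_pathP[x ->] /ext_pathP[y ->]; rewrite !ext_val;
    [apply: Pr | apply: Pc].
split=> [u|u u'|u u']; rewrite -!ext_val;
  [apply: P0|apply: Pr|apply: Pc]; apply: val_path.
Qed.

Lemma rpp_monomial_content P : rpp_on (mem p) (ext P) ->
  rpp_monomial P = content w (map (ext P) p).
Proof.
move=> rppP; apply/eqP/cmP => i; rewrite rpp_monomialE content_columns //.
rewrite /column_mult -card_fseq; congr #|` _|%fset; apply/fsetP => j.
rewrite !inE; apply/imfsetP/mapP => -[u]; rewrite ?inE ?mem_filter.
  move=> Pu ->; exists (val u) => //.
  by rewrite mem_filter ext_val val_path andbT.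
case/andP => Pu /ext_pathP[x xE] ->; exists x; last by rewrite xE.
by rewrite inE -ext_val -xE.
Qed.

Lemma map_ext_mk t : size t = size p -> map (ext (mk t)) p = t.
Proof.
move=> st; apply: (@eq_from_nth _ 0%N); first by rewrite size_map st.
rewrite size_map => i ip; rewrite (nth_map v) //.
have [x xE] := ext_pathP (mem_nth v ip).
by rewrite xE ext_val ffunE -xE index_uniq // ribbon_path_uniq.
Qed.

Lemma mk_map_ext P : mk (map (ext P) p) = P.
Proof.
by apply/ffunP => u; rewrite ffunE (nth_map v) ?index_mem // nth_index.
Qed.

Lemma rpp_all_fillings n P : reverse_plane_partition P ->
  (forall u, u \in p -> (ext P u <= n)%N) -> map (ext P) p \in all_fillings n w.
Proof.
move=> /rpp_on_ext[rppP P0] Pn.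
have range u : u \in p -> (0 < ext P u <= n)%N by move=> up; rewrite P0 ?Pn.
apply/flatten_mapP; exists (ext P v); last by apply/rpp_on_fillings.
by rewrite mem_index_iota ltnS range ?mem_head_path.
Qed.

Lemma all_fillings_rpp n t : t \in all_fillings n w ->
  reverse_plane_partition (mk t).
Proof.
move=> /all_fillingsP[a aI tI].
have st : size t = size p by rewrite (size_fillings tI) size_ribbon_path.
have mE := map_ext_mk st.
have range u : u \in p -> (0 < ext (mk t) u <= n)%N.
  by move=> up; apply: (fillings_range aI tI); have := map_f (ext (mk t)) up; rewrite mE.
apply/rpp_on_ext; split; last by move=> u /range/andP[].
apply/(rpp_on_fillings range); rewrite mE.
have [s sE] := fillings_head tI.
suff -> : ext (mk t) v = a by [].
have := congr1 (head 0%N) mE.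
have -> : p = v :: behead p by rewrite /p; case: (w).
by rewrite /= => ->; rewrite sE.
Qed.

(** A bound [n] on the variables of [m] bounds the entries of the reverse plane
    partitions with monomial [m], which leaves finitely many of them. *)
Lemma sum_rpp_contents n (m : {cmonom nat}) : (forall i, m i != 0%N -> (i <= n)%N) ->
  \sum_(P \in [set P | @reverse_plane_partition D P])
     series_monomial (rpp_monomial P) m
  = (count_mem m (contents n w))%:R.
Proof.
move=> mn; pose r := [seq mk t | t <- all_fillings n w].
have sizeF t : t \in all_fillings n w -> size t = size p.
  by case/all_fillingsP => a _ /size_fillings ->; rewrite size_ribbon_path.
have r_uniq : uniq r.
  rewrite map_inj_in_uniq ?all_fillings_uniq // => t t' tF tF' E.
  by rewrite -(map_ext_mk (sizeF _ tF)) E map_ext_mk ?sizeF.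
rewrite -(fsbig_widen [set` r]); first last.
- move=> P [/= rppP Pr]; rewrite /series_monomial; case: eqP => // Pm.
  case: Pr; apply/mapP; exists (map (ext P) p); last by rewrite mk_map_ext.
  apply: rpp_all_fillings => // u up; apply: mn.
  have [rppE _] := (rpp_on_ext P).1 rppP.
  rewrite -Pm rpp_monomialE cardfs_eq0; apply/fset0Pn.
  have [x xE] := ext_pathP up; exists (val x).2.
  by apply/imfsetP; exists x => //; rewrite !inE xE ext_val eqxx.
- by move=> P /= /mapP[t tF ->]; apply: all_fillings_rpp tF.
rewrite -fsbig_seq // big_map -sum1_count /contents.
rewrite big_map natr_sum big_mkcond /= [RHS]big_mkcond.
apply: eq_big_seq => t tF; rewrite /series_monomial.
have [rppE _] := (rpp_on_ext _).1 (all_fillings_rpp tF).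
rewrite rpp_monomial_content // map_ext_mk ?sizeF //.
by case: eqP.
Qed.

End DualCoefficient.

(** * Ribbons with equal dual stable Grothendieck polynomials *)

Lemma dual_count s v w n (m : {cmonom nat}) : diagram s =i ribbon_path v w ->
  (forall i, m i != 0%N -> (i <= n)%N) ->
  dual_stable_grothendieck s m = (count_mem m (contents n w))%:R.
Proof. by move=> sw mn; rewrite -(sum_rpp_contents sw mn). Qed.

(** Equality of all coefficients amounts to equality of [fill] for all numbers of
    variables: one direction evaluates the multisets of monomials at points, the
    other one reads the coefficients off the monoid algebra. *)
Lemma dual_eq_words s s' v v' w w' :
  diagram s =i ribbon_path v w -> diagram s' =i ribbon_path v' w' ->
  dual_stable_grothendieck s = dual_stable_grothendieck s' <->
  w = w' \/ w = rev w'.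
Proof.
move=> sw sw'; split=> [eqg|eqw].
  apply: (@words_determined algC) => n y; apply: fill_of_contents.
  apply/allP => m _ /=; apply/eqP.
  have [mn|/existsNP[i /not_implyP[mi /negP ni]]] :=
      pselect (forall i, m i != 0%N -> (i <= n)%N).
    have := dual_count sw mn; rewrite eqg (dual_count sw' mn).
    by move=> /eqP; rewrite eqr_nat => /eqP.
  have out u : m \notin contents n u.
    by apply/negP => /contents_support /(_ mi); apply/negP.
  by rewrite !(count_memPn _).
apply: funext => m; pose n := \max_(i <- finsupp m) i.
have mn i : m i != 0%N -> (i <= n)%N.
  by rewrite -mem_finsupp => im; apply: (@leq_bigmax_seq _ _ xpredT id).
rewrite (dual_count sw mn) (dual_count sw' mn) !count_contents.
by case: eqw => ->; rewrite ?fill_rev.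
Qed.

(** The constant coefficient tells the empty diagram from the other ones. *)
Lemma dual_empty s : diagram s = fset0 ->
  dual_stable_grothendieck s (onecm _) = 1.
Proof.
rewrite /dual_stable_grothendieck => ->.
have P0 (P Q : {ffun fset0 -> nat}) : P = Q by apply/ffunP => -[].
pose P1 : {ffun (@fset0 box) -> nat} := [ffun=> 0%N].
have -> : [set P | @reverse_plane_partition fset0 P] = [set P1].
  apply/seteqP; split=> P /= _; first exact: P0.
  by split=> -[].
rewrite fsbig_set1 /series_monomial (_ : rpp_monomial P1 = onecm _) ?eqxx //.
apply/eqP/cmP => i; rewrite rpp_monomialE onecmE; apply/eqP.
rewrite cardfs_eq0; apply/eqP/fsetP => j; rewrite in_fset0.
by apply/negP => /imfsetP[[]].
Qed.

Lemma dual_nonempty s : diagram s != fset0 ->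
  dual_stable_grothendieck s (onecm _) = 0.
Proof.
case/fset0Pn => u uD; rewrite /dual_stable_grothendieck fsbig1 // => P [P0 _ _].
rewrite /series_monomial; case: eqP => // /eqP/cmP /(_ (P [` uD])).
rewrite rpp_monomialE onecmE => /eqP; rewrite cardfs_eq0 => /eqP E.
have : u.2 \in @fset0 int by rewrite -E; apply/imfsetP; exists [` uD]; rewrite //= inE.
by rewrite in_fset0.
Qed.

Lemma translate_eq0 v D : (translate v D == fset0) = (D == fset0).
Proof.
apply/eqP/eqP => [E|->]; last first.
  by apply/fsetP => u; rewrite in_fset0; apply/negP => /imfsetP[].
apply/fsetP => u; rewrite in_fset0; apply/negP => uD.
have : u + v \in @fset0 box by rewrite -E; apply/imfsetP; exists u.
by rewrite in_fset0.
Qed.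

Lemma rot180_eq0 D : (rot180 D == fset0) = (D == fset0).
Proof.
apply/eqP/eqP => [E|->]; last first.
  by apply/fsetP => u; rewrite in_fset0; apply/negP => /imfsetP[].
apply/fsetP => u; rewrite in_fset0; apply/negP => uD.
have : - u \in @fset0 box by rewrite -E; apply/imfsetP; exists u.
by rewrite in_fset0.
Qed.

Lemma rot180_path (D : {fset box}) v w : D =i ribbon_path v w ->
  rot180 D =i ribbon_path (- last_box v w) (rev w).
Proof.
move=> Dw u; rewrite -ribbon_path_rot mem_rev.
by apply/imfsetP/mapP => -[x xD ->]; exists x; rewrite // ?Dw // -Dw.
Qed.

Lemma translate_path (D E : {fset box}) v v' w w' :
  D =i ribbon_path v w -> E =i ribbon_path v' w' ->
  eq_up_to_translation D E <-> w = w'.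
Proof.
move=> Dw Ew'; have tE t : translate t E =i ribbon_path (v' + t) w'.
  move=> u; rewrite ribbon_path_translate.
  by apply/imfsetP/mapP => -[x xD ->]; exists x; rewrite // ?Ew' // -Ew'.
split=> [[t Dt]|eqw].
  by apply: (@ribbon_path_inj v (v' + t)) => u; rewrite -Dw Dt tE.
by exists (v - v'); apply/fsetP => u; rewrite tE Dw eqw addrC subrK.
Qed.

Theorem theorem3p4 (alpha beta : skew_shape)
    (ribbon_alpha : ribbon alpha) (ribbon_beta : ribbon beta) :
  dual_stable_grothendieck alpha = dual_stable_grothendieck beta <->
  eq_up_to_translation (diagram alpha) (diagram beta) \/
  eq_up_to_translation (diagram alpha) (rot180 (diagram beta)).
Proof.
have [a0|a_ne] := eqVneq (diagram alpha) fset0;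
have [b0|b_ne] := eqVneq (diagram beta) fset0.
- split=> _; last by rewrite /dual_stable_grothendieck a0 b0.
  by left; exists 0; apply/eqP; rewrite a0 eq_sym translate_eq0 b0.
- split=> [eqg|H].
    by have := dual_empty a0; rewrite eqg dual_nonempty.
  by move: b_ne; case: H => -[t]; rewrite a0 => /esym/eqP;
    rewrite translate_eq0 ?rot180_eq0 => ->.
- split=> [eqg|H].
    by have := dual_empty b0; rewrite -eqg dual_nonempty.
  by move: a_ne; case: H => -[t] ->; rewrite translate_eq0 ?rot180_eq0 b0 eqxx.
have [v [w sw]] := ribbon_is_path ribbon_alpha a_ne.
have [v' [w' sw']] := ribbon_is_path ribbon_beta b_ne.
rewrite (dual_eq_words sw sw') (translate_path sw sw').
by rewrite (translate_path sw (rot180_path sw')).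
Qed.
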